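(* Consider the problem (SCO): given access to a stochastic gradient oracle for a differentiable, convex and $L$-Lipschitz function $f\colon\mathbb{R}^d\to\mathbb{R}$ such that there exists $x^\star\in\operatorname{argmin}_{x\in\mathbb{R}^d}f(x)$ with $\|x^\star\|\le R$, output an $\epsilon$-optimal point of $f$. Any algorithm which solves this problem with probability at least $2/3$ using a $(\sigma_I,\delta)$-ISGO makes at least $$\tilde\Omega\left(\frac{R^2\sigma_I^2}{\epsilon^2\log^2(1/\delta)}+\min\left\{\frac{R^2L^2}{\epsilon^2},\,d\right\}\right)$$ queries.
   Context: $\|\cdot\|$ is the Euclidean norm; Lipschitzness is with respect to it. A point $x$ is $\epsilon$-optimal if $f(x)\le \inf_y f(y)+\epsilon$. A stochastic gradient oracle (SGO) for $f$ is an oracle $\mathcal{O}$ which, when queried at $x\in\mathbb{R}^d$, outputs a random vector $\mathcal{O}(x)\in\mathbb{R}^d$ with $\mathbb{E}\,\mathcal{O}(x)=\nabla f(x)$; the randomness of each call is independent of previous calls. A $(\sigma_I,\delta)$-isotropic SGO ($(\sigma_I,\delta)$-ISGO) is an SGO $\mathcal{O}_I$ such that $\mathbb{P}\left[|\langle \mathcal{O}_I(x)-\nabla f(x),u\rangle|\ge \sigma_I/\sqrt d\right]\le\delta$ for all $x,u\in\mathbb{R}^d$ with $\|u\|=1$. $\tilde\Omega(\cdot)$ hides logarithmic factors in $d$.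
   Formalization: Assumes ε ≤ aLR for a fixed but arbitrary a < 1, with the hidden constant depending on a: for ε ≥ LR the point 0 is ε-optimal with no queries, so the claim fails; also takes L, R, σ_I, ε > 0 and 0 < δ < 1. *)

(* Defs.v *)
From HB Require Import structures.
From mathcomp Require Import all_boot all_order all_algebra.
From mathcomp Require Import all_classical all_reals all_analysis.

Set Implicit Arguments.
Unset Strict Implicit.
Unset Printing Implicit Defensive.

Import Order.TTheory GRing.Theory Num.Theory.
Import numFieldNormedType.Exports.

Local Open Scope classical_set_scope.
Local Open Scope ring_scope.

(* The Borel sigma-algebra of R^d, as the one generated by the coordinates. *)
Definition rV_display : measure_display.
Proof. exact: (measure_tuple_display default_measure_display). Qed.

Section measurable_rV.
Context {R : realType} {d : nat}.

Let coord : 'I_d -> 'rV[R]_d -> measurableTypeR R := fun i x => x ord0 i.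

Let rV_set0 : g_sigma_preimage coord set0.
Proof. exact: sigma_algebra0. Qed.

Let rV_setC A : g_sigma_preimage coord A -> g_sigma_preimage coord (~` A).
Proof. exact: sigma_algebraC. Qed.

Let rV_bigcup (F : (set 'rV[R]_d)^nat) :
  (forall i, g_sigma_preimage coord (F i)) ->
  g_sigma_preimage coord (\bigcup_i (F i)).
Proof. exact: sigma_algebra_bigcup. Qed.

HB.instance Definition _ := @isMeasurable.Build rV_display
  'rV[R]_d (g_sigma_preimage coord) rV_set0 rV_setC rV_bigcup.

End measurable_rV.

Section problem.
Context {R : realType} {d : nat}.
Implicit Types (f : 'rV[R]_d -> R) (x y u : 'rV[R]_d).

Definition dotp x y : R := \sum_(i < d) x ord0 i * y ord0 i.

(* The library norm on 'rV[R]_d is the sup norm; this is the Euclidean one. *)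
Definition enorm x : R := Num.sqrt (dotp x x).

Definition gradient f x : 'rV[R]_d := \row_(i < d) 'D_(delta_mx ord0 i) f x.

Definition elipschitz (L : R) f := forall x y, `|f x - f y| <= L * enorm (x - y).

Definition argmin f : set 'rV[R]_d := [set x | forall y, f x <= f y].

Definition sco_instance (L Rad : R) f :=
  [/\ forall x, differentiable f x,
      convex_function [set: convex_lmodType 'rV[R]_d] f,
      elipschitz L f
    & exists2 xstar, argmin f xstar & enorm xstar <= Rad].

Definition eps_optimal (eps : R) f : set 'rV[R]_d :=
  [set x | f x <= inf (range f) + eps].

(* [orc x] is the law of the answer to a query at [x]. *)
Definition oracle := R.-pker 'rV[R]_d ~> 'rV[R]_d.

Definition is_SGO f (orc : oracle) :=
  forall (x : 'rV[R]_d) (i : 'I_d),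
    (orc x).-integrable setT (fun y => (y ord0 i)%:E) /\
    (\int[orc x]_y (y ord0 i)%:E = (gradient f x ord0 i)%:E)%E.

Definition is_ISGO (sigma delta : R) f (orc : oracle) :=
  is_SGO f orc /\
  forall x u, enorm u = 1 ->
    (orc x [set y | (sigma / Num.sqrt d%:R <= `|dotp (y - gradient f x) u|)%R]
      <= delta%:E)%E.

End problem.

Arguments oracle : clear implicits.

(* A randomized adaptive query algorithm.  Its internal randomness is a seed
   drawn once from [seed_law]; after [t] answers it sees the seed together with
   these answers, and it either halts and outputs a point or makes the next
   query.  (The earlier queries are functions of the same data.) *)
Record algorithm (R : realType) (d : nat) := Algorithm {
  seed_display : measure_display;
  seed : measurableType seed_display;
  seed_law : probability seed R;
  halts : forall t : nat, seed * t.-tuple 'rV[R]_d -> bool;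
  query : forall t : nat, seed * t.-tuple 'rV[R]_d -> 'rV[R]_d;
  output : forall t : nat, seed * t.-tuple 'rV[R]_d -> 'rV[R]_d;
  measurable_halts : forall t, measurable_fun setT (@halts t);
  measurable_query : forall t, measurable_fun setT (@query t);
  measurable_output : forall t, measurable_fun setT (@output t)
}.

Section run.
Context {R : realType} {d : nat}.
Variables (A : algorithm R d) (orc : oracle R d) (G : set 'rV[R]_d).

(* Conditional probability, given the seed [s] and the [t] answers [h] obtained
   so far, that [A] halts after at most [n] further queries with an output in
   [G].  Integrating against [orc (query _)] draws a fresh answer, independent
   of the previous ones given the query point. *)
Fixpoint run_success (n t : nat) (s : seed A) (h : t.-tuple 'rV[R]_d) : \bar R :=
  if halts (s, h) then (\1_G (output (s, h)))%:E
  else if n is n'.+1 then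
    (\int[orc (query (s, h))]_y run_success n' s [tuple of rcons h y])%E
  else 0%E.

Definition success_probability (T : nat) : \bar R :=
  (\int[seed_law A]_s run_success T s [tuple])%E.

End run.

(* Runs that need more than [T] queries count as failures, so an algorithm that
   always halts within [T] queries is a special case. *)
Definition solves_SCO (R : realType) (d : nat) (A : algorithm R d) (T : nat)
    (L Rad eps sigma delta p : R) :=
  forall (f : 'rV[R]_d -> R) (orc : oracle R d),
    sco_instance L Rad f -> is_ISGO sigma delta f orc ->
    (p%:E <= success_probability A orc (eps_optimal eps f) T)%E.

(* Main.v *)
(* The two terms of the bound come from two independent families of instances;
   only the dimension term loses a logarithm, to the first power.

   Dimension term: hide signs [v] in the centre [r v] of the Chebyshev distance
   [L max_(i < k) |x_i - r v_i|], where [k] is of order [min (R^2 L^2 / eps^2, d)].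
   An [eps]-optimal point reveals all [k] signs, while away from the kinks an
   exact gradient is one of [2 d] vectors, so [T] queries leave at most
   [(2 d + 2)^T] outputs for [2^k] sign vectors.  Differentiability is obtained
   by smoothing each kink in a tiny neighbourhood, and a random shift of the
   centre makes all the queries of the finite transcript tree avoid these
   neighbourhoods.

   Noise term: hide signs in [gamma sum_i |x_i - r v_i|] and answer a query by the
   gradient plus, in coordinate [i], the gradient gap times a sum of [2 m] fair
   signs.  The hidden sign and the noise form [n = 2 m + 1] exchangeable signs, so
   that flipping [v_i] tilts the law of the answer by the mean of these signs,
   whose variance is [1 / n].  By Hellinger tensorization along the run [T]
   queries detect the flip of one sign with advantage [2 sqrt (T / n)], whereas
   an [eps]-optimal point correlates with the whole of [v].  The noise satisfies
   the isotropy condition for [n] of order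
   [R^2 sigma^2 / (eps^2 ln (1 / delta)^2)]: by the exponential moment when
   [delta] is away from [1], and by a small-ball estimate near [1]. *)

Require Import Defs.
From HB Require Import structures.
From mathcomp Require Import all_boot all_order all_algebra.
From mathcomp Require Import all_classical all_reals all_analysis.
From mathcomp Require Import measurable_realfun perm ring lra.

Set Implicit Arguments.
Unset Strict Implicit.
Unset Printing Implicit Defensive.

Import Order.TTheory GRing.Theory Num.Theory.
Import numFieldNormedType.Exports.
Local Open Scope classical_set_scope.
Local Open Scope ring_scope.

(** * Averages and measurability *)

Definition avg {R : realType} {I : finType} (F : I -> R) : R :=
  #|I|%:R^-1 * \sum_i F i.

Section avg.
Context {R : realType} {I : finType}.
Implicit Types F G : I -> R.

Lemma eq_avg F G : F =1 G -> avg F = avg G.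
Proof. by move=> FG; congr (_ * _); apply: eq_bigr => i _. Qed.

Lemma avgD F G : avg (fun i => F i + G i) = avg F + avg G.
Proof. by rewrite /avg big_split mulrDr. Qed.

Lemma avgZ (c : R) F : avg (fun i => c * F i) = c * avg F.
Proof. by rewrite /avg -mulr_sumr mulrCA. Qed.

Lemma avgB F G : avg (fun i => F i - G i) = avg F - avg G.
Proof. by rewrite /avg sumrB mulrBr. Qed.

Lemma avg_sum (J : Type) (r : seq J) (P : pred J) (F : J -> I -> R) :
  avg (fun i => \sum_(j <- r | P j) F j i) = \sum_(j <- r | P j) avg (F j).
Proof. by rewrite /avg exchange_big/= mulr_sumr. Qed.

Lemma ler_avg F G : (forall i, F i <= G i) -> avg F <= avg G.
Proof.
by move=> FG; rewrite ler_wpM2l ?invr_ge0 ?ler0n//; apply: ler_sum => i _.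
Qed.

Lemma avg_ge0 F : (forall i, 0 <= F i) -> 0 <= avg F.
Proof. by move=> F0; rewrite mulr_ge0 ?invr_ge0 ?ler0n ?sumr_ge0. Qed.

Lemma avg_cst (i0 : I) (c : R) : avg (fun _ : I => c) = c.
Proof.
rewrite /avg sumr_const -[c *+ _]mulr_natl mulrA mulVf ?mul1r// pnatr_eq0 -lt0n.
by apply/card_gt0P; exists i0.
Qed.

Lemma reindex_avg (s : I -> I) F : involutive s -> avg F = avg (F \o s).
Proof. by move=> sK; rewrite /avg (reindex_inj (inv_inj sK)). Qed.

End avg.

Section measurable_rV.
Context {R : realType} {d : nat}.

Lemma measurable_coord (i : 'I_d) :
  measurable_fun [set: 'rV[R]_d] (fun x : 'rV[R]_d => x ord0 i).
Proof.
move=> _ Y mY; rewrite setTI; apply: sub_sigma_algebra => /=.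
rewrite -bigcup_seq/=; exists i => /=; first by rewrite mem_index_enum.
by exists Y => //; rewrite setTI.
Qed.

Lemma measurable_rVP d' (T : measurableType d') (f : T -> 'rV[R]_d) :
  measurable_fun setT f <->
  forall i, measurable_fun setT (fun t => f t ord0 i).
Proof.
split=> [mf i|mf]; first exact: (measurableT_comp (measurable_coord i)).
apply: (@measurability _ _ _ _ _ f (\big[setU/set0]_(i < d)
  preimage_set_system setT (fun x : 'rV[R]_d => x ord0 i : measurableTypeR R)
    measurable)) => //.
move=> _ [A + <-]; rewrite -bigcup_seq => -[i _ [B mB <-]].
by rewrite setTI; apply: mf.
Qed.

Lemma measurable_rcons d' (T : measurableType d') d'' (S : measurableType d'')
    (n : nat) (f : T -> S) (g : T -> n.-tuple S) :
  measurable_fun setT f -> measurable_fun setT g ->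
  measurable_fun setT (fun t => [tuple of rcons (g t) (f t)]).
Proof.
move=> mf mg; apply/measurable_fun_tnthP => i.
have [ltin|lein] := ltnP i n.
  rewrite (_ : _ \o _ = (fun t => tnth (g t) (Ordinal ltin))).
    exact: (measurableT_comp (measurable_tnth _)).
  apply/funext => t /=; rewrite !(tnth_nth (f t))/= nth_rcons size_tuple.
  by rewrite ltin.
rewrite (_ : _ \o _ = f)//.
apply/funext => t /=; rewrite !(tnth_nth (f t))/= nth_rcons size_tuple.
by rewrite ltnNge lein/= if_same.
Qed.

End measurable_rV.

(** * Runs against oracles with finitely many answers *)

Section unif_oracle.
Context {R : realType} {d : nat} {I : finType} (i0 : I).
Variable Phi : I -> 'rV[R]_d -> 'rV[R]_d.

(* The measurability proof is an argument so that the kernel instance can be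
   inferred. *)
Definition unif_law (mPhi : forall i, measurable_fun setT (Phi i))
    (x : 'rV[R]_d) : {measure set 'rV[R]_d -> \bar R} :=
  mscale (#|I|%:R^-1)%:nng
    (msum (fun k => \d_(Phi (nth i0 (enum I) k) x)) #|I|).

Lemma sum_nth_enum (V : nmodType) (F : I -> V) :
  \sum_(k < #|I|) F (nth i0 (enum I) k) = \sum_i F i.
Proof.
rewrite -[RHS]big_enum/= (big_nth i0) big_mkord -cardT.
by apply: eq_bigr.
Qed.

Hypothesis mPhi : forall i, measurable_fun setT (Phi i).
Local Notation law := (unif_law mPhi).

Lemma unif_lawE x A :
  law x A = (avg (fun i => \1_A (Phi i x)))%:E.
Proof.
rewrite /unif_law /= /mscale/= /msum/= EFinM; congr (_ * _)%E.
by rewrite sumEFin -(sum_nth_enum (fun i => \1_A (Phi i x))).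
Qed.

Let measurable_unif_law U : measurable U ->
  measurable_fun [set: 'rV[R]_d] (fun x => law x U).
Proof.
move=> mU; rewrite (_ : (fun x => law x U) =
  (fun x => (avg (fun i => \1_U (Phi i x)))%:E)); last first.
  by apply/funext => x /=; rewrite unif_lawE.
apply/measurable_EFinP; apply: measurable_funM => //.
apply: measurable_sum => i.
exact: (measurableT_comp (@measurable_indic _ _ R setT U mU) (mPhi i)).
Qed.

HB.instance Definition _ :=
  isKernel.Build _ _ _ _ R law measurable_unif_law.

Let unif_law_prob x : law x setT = 1%E.
Proof.
rewrite unif_lawE; under eq_avg do rewrite indicT.
by rewrite (avg_cst i0).
Qed.

HB.instance Definition _ :=
  Kernel_isProbability.Build _ _ _ _ R law unif_law_prob.

Definition unif_oracle : oracle R d := law.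

Lemma ge0_integral_unif_oracle x (F : 'rV[R]_d -> R) :
  (forall y, 0 <= F y) -> measurable_fun setT F ->
  (\int[unif_oracle x]_y (F y)%:E = (avg (fun i => F (Phi i x)))%:E)%E.
Proof.
move=> F0 mF; have mEF : measurable_fun setT (EFin \o F) by exact/measurable_EFinP.
rewrite /unif_oracle /unif_law ge0_integral_mscale//; last by move=> y _; rewrite lee_fin.
rewrite ge0_integral_measure_sum//; last by move=> y _; rewrite lee_fin.
under eq_bigr do rewrite integral_dirac// diracT mul1e.
by rewrite sumEFin (sum_nth_enum (fun i => F (Phi i x))) -EFinM.
Qed.

Lemma integrable_unif_oracle x (F : 'rV[R]_d -> R) :
  measurable_fun setT F -> (unif_oracle x).-integrable setT (EFin \o F).
Proof.
move=> mF; apply/integrableP; split; first exact/measurable_EFinP.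
rewrite (eq_integral (fun y => (`|F y|)%:E))//.
by rewrite ge0_integral_unif_oracle ?ltry//; exact: measurableT_comp.
Qed.

Lemma integral_unif_oracle x (F : 'rV[R]_d -> R) :
  measurable_fun setT F ->
  (\int[unif_oracle x]_y (F y)%:E = (avg (fun i => F (Phi i x)))%:E)%E.
Proof.
move=> mF.
have maxB (r : R) : Num.max r 0 - Num.max (- r) 0 = r.
  have [r0|r0] := leP 0 r.
    by rewrite max_r ?oppr_le0// subr0.
  by rewrite max_l ?oppr_ge0 ?ltW// sub0r opprK.
pose p y := Num.max (F y) 0; pose n y := Num.max (- F y) 0.
have mp : measurable_fun setT p by exact: measurable_maxr.
have mn : measurable_fun setT n.
  by apply: measurable_maxr => //; exact: measurableT_comp.
rewrite (eq_integral ((EFin \o p) \- (EFin \o n))%E); last first.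
  by move=> y _ /=; rewrite -EFinB maxB.
rewrite integralB//; try exact: integrable_unif_oracle.
rewrite !ge0_integral_unif_oracle//; try by move=> y; rewrite /p /n le_max lexx orbT.
rewrite -EFinB -avgB; congr (_%:E); apply: eq_avg => i.
exact: maxB.
Qed.

End unif_oracle.

Section run.
Context {R : realType} {d : nat} {I : finType} (i0 : I).
Variable Phi : I -> 'rV[R]_d -> 'rV[R]_d.
Hypothesis mPhi : forall i, measurable_fun setT (Phi i).
Variables (A : algorithm R d) (G : 'rV[R]_d -> R).

Fixpoint run_value (n t : nat) (s : seed A) (h : t.-tuple 'rV[R]_d) : R :=
  if halts (s, h) then G (output (s, h))
  else if n is n'.+1 then
    avg (fun i => run_value n' s [tuple of rcons h (Phi i (query (s, h)))])
  else 0.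

Hypothesis mG : measurable_fun setT G.

Lemma measurable_run_value n t :
  measurable_fun setT (fun sh : seed A * t.-tuple 'rV[R]_d => run_value n sh.1 sh.2).
Proof.
elim: n t => [|n IH] t /=.
  rewrite (_ : (fun _ => _) = fun sh => if @halts _ _ A t sh
    then G (@output _ _ A t sh) else 0); last first.
    by apply/funext => -[].
  apply: measurable_fun_ifT => //; first exact: measurable_halts.
  exact: (measurableT_comp mG (@measurable_output _ _ A t)).
rewrite (_ : (fun _ => _) = fun sh => if @halts _ _ A t sh
  then G (@output _ _ A t sh)
  else avg (fun i => run_value n sh.1
    [tuple of rcons sh.2 (Phi i (@query _ _ A t sh))])); last first.
  by apply/funext => -[].
apply: measurable_fun_ifT; first exact: measurable_halts.
  exact: (measurableT_comp mG (@measurable_output _ _ A t)).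
apply: measurable_funM => //; apply: measurable_sum => i.
have mh : measurable_fun setT (fun sh : seed A * t.-tuple 'rV[R]_d =>
    (sh.1, [tuple of rcons sh.2 (Phi i (query sh))])).
  apply: measurable_fun_pair => //; apply: measurable_rcons => //.
  exact: (measurableT_comp (mPhi i) (@measurable_query _ _ A t)).
exact: (measurableT_comp (IH t.+1) mh).
Qed.

Lemma run_value_ge0 n t s (h : t.-tuple 'rV[R]_d) :
  (forall x, 0 <= G x) -> 0 <= run_value n s h.
Proof.
move=> G0; elim: n t h => [|n IH] t h /=; case: ifP => // _.
by apply: avg_ge0 => i; exact: IH.
Qed.

Lemma run_value_le1 n t s (h : t.-tuple 'rV[R]_d) :
  (forall x, G x <= 1) -> run_value n s h <= 1.
Proof.
move=> G0; elim: n t h => [|n IH] t h /=; case: ifP => // _.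
by rewrite -(avg_cst i0 1); apply: ler_avg => i; exact: IH.
Qed.

End run.

Section run_success.
Context {R : realType} {d : nat} {I : finType} (i0 : I).
Variable Phi : I -> 'rV[R]_d -> 'rV[R]_d.
Hypothesis mPhi : forall i, measurable_fun setT (Phi i).
Variables (A : algorithm R d) (G : set 'rV[R]_d).
Hypothesis mG : measurable G.

Lemma run_success_value n t (s : seed A) (h : t.-tuple 'rV[R]_d) :
  run_success (unif_oracle i0 mPhi) G n s h = (run_value Phi \1_G n s h)%:E.
Proof.
elim: n t h => [|n IH] t h /=; case: ifP => // _.
under eq_integral do rewrite IH.
rewrite ge0_integral_unif_oracle//; first by move=> y; exact: run_value_ge0.
have mR := @measurable_run_value R d I Phi mPhi A _ (@measurable_indic _ _ R setT G mG) n t.+1.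
have mh : measurable_fun setT (fun y => (s, [tuple of rcons h y])).
  by apply: measurable_fun_pair => //; exact: measurable_rcons.
exact: (measurableT_comp mR mh).
Qed.

Lemma success_probability_value T :
  success_probability A (unif_oracle i0 mPhi) G T =
  (\int[seed_law A]_s (run_value Phi \1_G T s [tuple])%:E)%E.
Proof. by apply: eq_integral => s _; rewrite run_success_value. Qed.

Lemma measurable_run_value_seed T :
  measurable_fun setT (fun s : seed A => run_value Phi \1_G T s [tuple]).
Proof.
have mR := @measurable_run_value R d I Phi mPhi A _ (@measurable_indic _ _ R setT G mG) T 0.
have mh : measurable_fun setT (fun s : seed A => (s, [tuple] : 0.-tuple 'rV[R]_d)).
  exact: measurable_fun_pair.
exact: (measurableT_comp mR mh).
Qed.

End run_success.

Lemma unif_oracle_ISGO {R : realType} {d : nat} {I : finType} (i0 : I)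
    (Phi : I -> 'rV[R]_d -> 'rV[R]_d)
    (mPhi : forall i, measurable_fun setT (Phi i)) (sigma delta : R) f :
  (forall x j, avg (fun i => Phi i x ord0 j) = gradient f x ord0 j) ->
  (forall x u, enorm u = 1 ->
    avg (fun i => (sigma / Num.sqrt d%:R <= `|dotp (Phi i x - gradient f x) u|)%R%:R)
      <= delta) ->
  is_ISGO sigma delta f (unif_oracle i0 mPhi).
Proof.
move=> Hgrad Htail; split=> [x j|x u u1].
  have mc := @measurable_coord R d j.
  split; first exact: (integrable_unif_oracle i0 mPhi x mc).
  by rewrite integral_unif_oracle// Hgrad.
rewrite /unif_oracle unif_lawE lee_fin; apply: le_trans (Htail x u u1).
apply: ler_avg => i; rewrite indicE; case: (boolP (_ \in _)) => [/set_mem/= ->//|_].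
exact: ler0n.
Qed.

Lemma avg_success_probability {R : realType} {d : nat} {I J : finType}
    (i0 : I) (j0 : J) (Phi : J -> I -> 'rV[R]_d -> 'rV[R]_d)
    (mPhi : forall j i, measurable_fun setT (Phi j i))
    (A : algorithm R d) (G : J -> set 'rV[R]_d) (T : nat) (p C : R) :
  (forall j, measurable (G j)) ->
  (forall j,
    (p%:E <= success_probability A (unif_oracle i0 (mPhi j)) (G j) T)%E) ->
  (forall s : seed A, avg (fun j => run_value (Phi j) \1_(G j) T s [tuple]) <= C) ->
  p <= C.
Proof.
move=> mG Hp HC.
have J0 : 0 < #|J|%:R :> R by rewrite ltr0n; apply/card_gt0P; exists j0.
rewrite -(ler_pM2l J0) -lee_fin.
have rv0 j (s : seed A) : 0 <= run_value (Phi j) \1_(G j) T s ([tuple] : 0.-tuple _).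
  exact: run_value_ge0.
have mrv j := @measurable_run_value_seed _ _ _ _ (mPhi j) A (G j) (mG j) T.
apply: (@le_trans _ _
    (\sum_j \int[seed_law A]_s (run_value (Phi j) \1_(G j) T s [tuple])%:E)%E).
  have -> : (#|J|%:R * p)%:E = (\sum_(j : J) p%:E)%E.
    by rewrite sumEFin sumr_const mulr_natl.
  apply: lee_sum => j _; rewrite -(success_probability_value i0 (mPhi j) A (mG j)).
  exact: Hp.
rewrite -ge0_integral_sum//; last 2 first.
  by move=> j; apply/measurable_EFinP; exact: mrv.
  by move=> j s _; rewrite lee_fin.
apply: (@le_trans _ _ (\int[seed_law A]_s (cst (#|J|%:R * C)%:E s))%E).
  apply: ge0_le_integral => //.
  - by move=> s _; apply: sume_ge0 => j _; rewrite lee_fin.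
  - by apply: emeasurable_sum => j; apply/measurable_EFinP; exact: mrv.
  - move=> s _ /=; rewrite sumEFin lee_fin -ler_pdivrMl//.
    exact: (HC s).
rewrite integral_cst// [X in (_ * X)%E](_ : _ = 1%E) ?mule1//.
exact: probability_setT.
Qed.

(** * Smooth convex functions *)

Section dotp.
Context {R : realType} {d : nat}.
Implicit Types x y z : 'rV[R]_d.

Lemma dotpDr x y z : dotp x (y + z) = dotp x y + dotp x z.
Proof. by rewrite -big_split; apply: eq_bigr => i _; rewrite mxE mulrDr. Qed.

Lemma dotpZr a x y : dotp x (a *: y) = a * dotp x y.
Proof. by rewrite mulr_sumr; apply: eq_bigr => i _; rewrite mxE mulrCA. Qed.

Lemma dotpC x y : dotp x y = dotp y x.
Proof. by apply: eq_bigr => i _; rewrite mulrC. Qed.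

Lemma dotpDl x y z : dotp (x + y) z = dotp x z + dotp y z.
Proof. by rewrite dotpC dotpDr !(dotpC z). Qed.

Lemma dotpZl a x y : dotp (a *: x) y = a * dotp x y.
Proof. by rewrite dotpC dotpZr dotpC. Qed.

Lemma dotp0l x : dotp 0 x = 0.
Proof. by apply: big1 => i _; rewrite mxE mul0r. Qed.

Lemma dotp_delta i x : dotp (delta_mx ord0 i) x = x ord0 i.
Proof.
rewrite /dotp (bigD1 i)//= mxE !eqxx mul1r big1 ?addr0// => j ji.
by rewrite mxE (negbTE ji) andbF mul0r.
Qed.

Lemma dotpp_ge0 x : 0 <= dotp x x.
Proof. by apply: sumr_ge0 => i _; rewrite -expr2 sqr_ge0. Qed.

Lemma enorm_ge0 x : 0 <= enorm x.
Proof. exact: sqrtr_ge0. Qed.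

Lemma enorm_sqr x : enorm x ^+ 2 = dotp x x.
Proof. by rewrite sqr_sqrtr// dotpp_ge0. Qed.

Lemma ler_coord_enorm x i : `|x ord0 i| <= enorm x.
Proof.
rewrite -(ler_pXn2r (n := 2)) ?nnegrE ?enorm_ge0// enorm_sqr real_normK ?num_real//.
rewrite /dotp (bigD1 i)//= -expr2 lerDl.
by apply: sumr_ge0 => j _; rewrite -expr2 sqr_ge0.
Qed.

Lemma dotpp_le_norm x : dotp x x <= d%:R * `|x| ^+ 2.
Proof.
have xi i : x ord0 i * x ord0 i <= `|x| ^+ 2.
  rewrite -expr2 -real_normK ?num_real// lerXn2r ?nnegrE//.
  by rewrite [leRHS]/Num.norm /= mx_normrE; apply/bigmax_geP; right => /=; exists (ord0, i).
apply: (le_trans (ler_sum _ (fun i _ => xi i))).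
by rewrite sumr_const card_ord mulr_natl.
Qed.

Lemma dotp_continuous g : continuous (dotp g : 'rV[R]_d -> R).
Proof.
move=> x; rewrite /dotp; elim: (index_enum _) => [|i r IH].
  rewrite (_ : (fun y => _) = cst 0); last first.
    by apply/funext => y; rewrite big_nil.
  exact: cst_continuous.
rewrite (_ : (fun y => _) = (fun y : 'rV[R]_d => g ord0 i * y ord0 i) +
    (fun y => \sum_(j <- r) g ord0 j * y ord0 j)); last first.
  by apply/funext => y; rewrite big_cons.
apply: continuousD; last exact: IH.
apply: continuousM; first exact: cst_continuous.
exact: coord_continuous.
Qed.

Lemma quadratic_diff (F : 'rV[R]_d -> R) (g x : 'rV[R]_d) (K : R) :
  (forall h, `|F (h + x) - F x - dotp g h| <= K * dotp h h) ->
  differentiable F x /\ ('d F x = dotp g :> ('rV[R]_d -> R)).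
Proof.
move=> HK.
have lin : linear (dotp g : 'rV[R]_d -> R) by move=> a u v; rewrite dotpDr dotpZr.
pose dM := GRing.isLinear.Build _ _ _ _ _ lin.
pose dL : {linear _ -> _} := HB.pack (dotp g : 'rV[R]_d -> R) dM.
have Hexp : F \o shift x = cst (F x) + (dL : 'rV[R]_d -> R) +o_ (0 : 'rV[R]_d) id.
  apply/eqaddoP => e e0.
  pose C := `|K| * d%:R + 1.
  have C0 : 0 < C by rewrite ltr_pwDr// mulr_ge0.
  near=> h.
  rewrite /= -[X in `|X|]/(F (h + x) - (F x + dotp g h)) opprD addrA.
  apply: (le_trans (HK h)); apply: (@le_trans _ _ (C * `|h| ^+ 2)).
    apply: (@le_trans _ _ (`|K| * dotp h h)); first by rewrite ler_wpM2r ?dotpp_ge0 ?ler_norm.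
    apply: (@le_trans _ _ (`|K| * (d%:R * `|h| ^+ 2))).
      by rewrite ler_wpM2l// dotpp_le_norm.
    by rewrite mulrA ler_wpM2r ?sqr_ge0// lerDl.
  rewrite expr2 mulrA ler_wpM2r//.
  rewrite -ler_pdivlMl//.
  near: h; apply: (@nbhs0_le _ 'rV[R]_d); by rewrite mulr_gt0 ?invr_gt0.
have dc : continuous dL by exact: dotp_continuous.
have dE : 'd F x = dL :> ('rV[R]_d -> R) by exact: diff_unique.
split; last exact: dE.
apply/diff_locallyP; rewrite dE; split; [exact: dc|exact: Hexp].
Unshelve. all: by end_near. Qed.

Definition smooth_convex (F : 'rV[R]_d -> R) (g : 'rV[R]_d -> 'rV[R]_d) :=
  exists K, forall x y,
    0 <= F y - F x - dotp (g x) (y - x) <= K * dotp (y - x) (y - x).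

Lemma smooth_convex_diff F g x : smooth_convex F g ->
  differentiable F x /\ ('d F x = dotp (g x) :> ('rV[R]_d -> R)).
Proof.
move=> [K HK]; apply: (@quadratic_diff _ _ _ K) => h.
by have := HK x (h + x); rewrite addrK => /andP[h0 hK]; rewrite ger0_norm.
Qed.

Lemma smooth_convex_gradient F g : smooth_convex F g -> gradient F = g.
Proof.
move=> Fg; apply/funext => x; apply/rowP => i; rewrite mxE.
have [dF dE] := smooth_convex_diff x Fg.
by rewrite deriveE// dE dotpC dotp_delta.
Qed.

Lemma smooth_convex_convex F g : smooth_convex F g ->
  convex_function [set: convex_lmodType 'rV[R]_d] F.
Proof.
move=> [K HK] t x y _ _.
set z := conv t x y.
have tz : z = t%:inum *: x + (1 - t%:inum) *: y by [].
have zx : x - z = (1 - t%:inum) *: (x - y).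
  rewrite tz; apply/rowP => i; rewrite !mxE; ring.
have zy : y - z = (- t%:inum) *: (x - y).
  rewrite tz; apply/rowP => i; rewrite !mxE; ring.
have /andP[hx _] := HK z x; have /andP[hy _] := HK z y.
rewrite zx dotpZr in hx; rewrite zy dotpZr in hy.
have -> : conv t (F x : R^o) (F y : R^o) = t%:inum * F x + (1 - t%:inum) * F y by [].
have t0 : 0 <= t%:inum :> R by [].
have t1 : t%:inum <= 1 :> R by [].
move: hx hy; set D := dotp _ _; set s : R := t%:inum => hx hy.
have p1 := mulr_ge0 t0 hx.
have p2 : 0 <= (1 - s) * (F y - F z - - s * D).
  by apply: mulr_ge0 => //; rewrite subr_ge0.
rewrite -subr_ge0; apply: le_trans (addr_ge0 p1 p2) _.
by rewrite le_eqVlt; apply/orP; left; apply/eqP; rewrite /s; ring.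
Qed.

End dotp.

Section sabs.
Context {R : realType} (mu : R).

Definition dsabs (t : R) : R := Num.max (-1) (Num.min 1 (t / mu)).

(* The Huber function [max_(|k| <= 1) (k t + mu (1 - k^2) / 2)], written at the
   maximizer [k = dsabs t]. *)
Definition sabs (t : R) : R := dsabs t * t + mu * (1 - dsabs t ^+ 2) / 2.

Hypothesis mu0 : 0 < mu.

Lemma dsabs_bound t : -1 <= dsabs t <= 1.
Proof. by rewrite /dsabs le_max lexx/= ge_max ge_min lexx/= andbT. Qed.

Lemma dsabs_norm t : `|dsabs t| <= 1.
Proof. by rewrite ler_norml dsabs_bound. Qed.

Lemma dsabs_vi t k : -1 <= k <= 1 -> (t - mu * dsabs t) * (k - dsabs t) <= 0.
Proof.
move=> /andP[k1 k2]; have tE : t = mu * (t / mu) by rewrite mulrC divfK ?gt_eqF.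
rewrite {1}tE -mulrBr -mulrA pmulr_rle0//; set u := t / mu.
rewrite /dsabs -/u; have [u1|u1] := leP 1 u.
  rewrite max_r; last by lra.
  by apply: mulr_ge0_le0; lra.
have [u2|u2] := leP u (-1).
  by apply: mulr_le0_ge0; lra.
by rewrite subrr mul0r.
Qed.

Lemma dsabs0 : dsabs 0 = 0.
Proof. by rewrite /dsabs mul0r min_r// max_r// lerN10. Qed.

Lemma dsabs_ge t : mu <= t -> dsabs t = 1.
Proof.
move=> mut; rewrite /dsabs min_l; first by rewrite max_r; lra.
by rewrite ler_pdivlMr ?mul1r.
Qed.

Lemma dsabs_le t : t <= - mu -> dsabs t = -1.
Proof.
move=> tmu; have tm1 : t / mu <= -1 by rewrite ler_pdivrMr// mulN1r.
by rewrite /dsabs min_r ?max_l//; lra.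
Qed.

Lemma le_sabs k t : -1 <= k <= 1 -> k * t + mu * (1 - k ^+ 2) / 2 <= sabs t.
Proof.
move=> /(dsabs_vi t); rewrite /sabs; set c := dsabs t => vi.
have : 0 <= mu * (k - c) ^+ 2 by rewrite mulr_ge0 ?sqr_ge0 ?ltW.
lra.
Qed.

Lemma sabs_tangent s t : 0 <= sabs s - sabs t - dsabs t * (s - t).
Proof. by have := le_sabs s (dsabs_bound t); rewrite /sabs; lra. Qed.

Lemma sabs_smooth s t :
  sabs s - sabs t - dsabs t * (s - t) <= (s - t) ^+ 2 / (2 * mu).
Proof.
have vi := dsabs_vi t (dsabs_bound s).
rewrite ler_pdivlMr ?mulr_gt0//.
have : 0 <= (s - t - mu * (dsabs s - dsabs t)) ^+ 2 by exact: sqr_ge0.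
have : 0 <= mu * - ((t - mu * dsabs t) * (dsabs s - dsabs t)).
  by rewrite mulr_ge0 ?oppr_ge0// ltW.
rewrite /sabs; set a := dsabs s; set b := dsabs t; lra.
Qed.

Lemma normr_le_sabs t : `|t| <= sabs t.
Proof.
by rewrite ler_norml; have := @le_sabs 1 t; have := @le_sabs (-1) t; lra.
Qed.

Lemma sabs_le t : sabs t <= `|t| + mu / 2.
Proof.
have h1 : dsabs t * t <= `|t|.
  by rewrite (le_trans (ler_norm _))// normrM ler_piMl// dsabs_norm.
have h2 : 0 <= mu * dsabs t ^+ 2 by rewrite mulr_ge0 ?sqr_ge0 ?ltW.
by rewrite /sabs; lra.
Qed.

Lemma sabsE t : mu <= `|t| -> sabs t = `|t|.
Proof.
case: ger0P => t0 h; rewrite /sabs.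
  by rewrite dsabs_ge//; lra.
by rewrite dsabs_le ?expr2; lra.
Qed.

Lemma sabs0 : sabs 0 = mu / 2.
Proof. by rewrite /sabs dsabs0; lra. Qed.

Lemma sabs0_le t : sabs 0 <= sabs t.
Proof. by have := sabs_tangent t 0; rewrite dsabs0; lra. Qed.

Lemma sabs_lip s t : `|sabs s - sabs t| <= `|s - t|.
Proof.
have bound u v : sabs v - sabs u <= `|u - v|.
  have := sabs_tangent u v.
  have : - (dsabs v * (u - v)) <= `|u - v|.
    by rewrite -mulNr (le_trans (ler_norm _))// normrM normrN ler_piMl// dsabs_norm.
  lra.
have b1 := bound s t; have b2 := bound t s; rewrite distrC in b2.
by rewrite ler_norml; apply/andP; split; lra.
Qed.

Lemma measurable_dsabs : measurable_fun setT dsabs.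
Proof.
apply: measurable_maxr => //; apply: measurable_minr => //.
exact: measurable_funM.
Qed.

Lemma measurable_sabs : measurable_fun setT sabs.
Proof.
have := measurable_dsabs => md.
apply: measurable_funD; first exact: measurable_funM.
do 2 apply: measurable_funM => //.
by apply: measurable_funB => //; exact: measurable_funX.
Qed.

Definition smax (a b : R) : R := (a + b + sabs (a - b)) / 2.
Definition smaxw (a b : R) : R := (1 + dsabs (a - b)) / 2.

Lemma smaxw_bound a b : 0 <= smaxw a b <= 1.
Proof. by have := dsabs_bound (a - b); rewrite /smaxw; lra. Qed.

Lemma smax_gel a b : a <= smax a b.
Proof. by have := normr_le_sabs (a - b); rewrite ler_norml /smax; lra. Qed.

Lemma smax_ger a b : b <= smax a b.
Proof. by have := normr_le_sabs (a - b); rewrite ler_norml /smax; lra. Qed.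

Lemma smax_le a b : smax a b <= Num.max a b + mu / 4.
Proof.
have := sabs_le (a - b); rewrite /smax; have [ab|ab] := leP a b.
  by rewrite ler0_norm ?subr_le0//; lra.
by rewrite gtr0_norm ?subr_gt0//; lra.
Qed.

Lemma smax_tangent a b a' b' : 0 <= smax a' b' - smax a b -
  (smaxw a b * (a' - a) + (1 - smaxw a b) * (b' - b)).
Proof. by have := sabs_tangent (a' - b') (a - b); rewrite /smax /smaxw; lra. Qed.

Lemma smax_smooth a b a' b' : smax a' b' - smax a b -
  (smaxw a b * (a' - a) + (1 - smaxw a b) * (b' - b))
  <= ((a' - a) - (b' - b)) ^+ 2 / (4 * mu).
Proof.
have := sabs_smooth (a' - b') (a - b).
have -> : (a' - b' - (a - b)) ^+ 2 / (2 * mu) =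
          2 * ((a' - a - (b' - b)) ^+ 2 / (4 * mu)).
  by field; rewrite gt_eqF.
rewrite /smax /smaxw; lra.
Qed.

Lemma smax_homo a b a' b' : a <= a' -> b <= b' -> smax a b <= smax a' b'.
Proof.
move=> aa bb; have := smax_tangent a b a' b'; have := smaxw_bound a b; nra.
Qed.

Lemma smax_lip a b a' b' e : `|a' - a| <= e -> `|b' - b| <= e ->
  `|smax a' b' - smax a b| <= e.
Proof.
have bound a1 b1 a2 b2 : `|a2 - a1| <= e -> `|b2 - b1| <= e ->
    - e <= smax a2 b2 - smax a1 b1.
  rewrite !ler_norml => h1 h2.
  have := smax_tangent a1 b1 a2 b2; have := smaxw_bound a1 b1; nra.
move=> h1 h2; rewrite ler_norml bound//=.
by rewrite -[leRHS]opprK lerNr opprB bound// distrC.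
Qed.

Lemma smax_left a b : mu <= a - b -> smax a b = a /\ smaxw a b = 1.
Proof.
move=> h; have ab : 0 <= a - b by rewrite (le_trans _ h)// ltW.
rewrite /smax /smaxw dsabs_ge// sabsE ger0_norm//; lra.
Qed.

Lemma smax_right a b : mu <= b - a -> smax a b = b /\ smaxw a b = 0.
Proof.
move=> h; have ab : 0 <= b - a by rewrite (le_trans _ h)// ltW.
by rewrite /smax /smaxw dsabs_le ?sabsE ?[`|a - b|]distrC ?ger0_norm//; lra.
Qed.

End sabs.

Section instances.
Context {R : realType} {d : nat}.
Implicit Types (F : 'rV[R]_d -> R) (x y : 'rV[R]_d).

Lemma smooth_convexZ (a : R) F g : 0 <= a -> smooth_convex F g ->
  smooth_convex (fun x => a * F x) (fun x => a *: g x).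
Proof.
move=> a0 [K HK]; exists (a * K) => x y; rewrite dotpZl.
have /andP[h1 h2] := HK x y.
have -> : a * F y - a * F x - a * dotp (g x) (y - x) =
          a * (F y - F x - dotp (g x) (y - x)) by ring.
by rewrite mulr_ge0//= -mulrA ler_wpM2l.
Qed.

Lemma sco_instance_smooth (L Rad : R) F g xstar :
  smooth_convex F g -> elipschitz L F -> (forall y, F xstar <= F y) ->
  enorm xstar <= Rad -> sco_instance L Rad F.
Proof.
move=> Fg FL Fs xR; split => //.
- by move=> x; have [] := smooth_convex_diff x Fg.
- exact: smooth_convex_convex Fg.
- by exists xstar.
Qed.

Lemma eps_optimal_le (eps : R) F xstar x : (forall y, F xstar <= F y) ->
  eps_optimal eps F x -> F x <= F xstar + eps.
Proof.
move=> Fs /= h; apply: (le_trans h); rewrite lerD2r.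
apply: ge_inf; last by exists xstar.
by exists (F xstar) => _ [y _ <-].
Qed.

Lemma measurable_eps_optimal (eps : R) F : measurable_fun setT F ->
  measurable (eps_optimal eps F).
Proof.
move=> mF; rewrite (_ : eps_optimal eps F =
  setT `&` F @^-1` `]-oo, inf (range F) + eps]%classic); last first.
  by rewrite setTI; apply/seteqP; split=> x /=; rewrite in_itv.
exact: mF.
Qed.

Lemma dotpp_sum x : dotp x x = \sum_i x ord0 i ^+ 2.
Proof. by apply: eq_bigr => i _; rewrite expr2. Qed.

Lemma ler_sum_norm_enorm x :
  \sum_i `|x ord0 i| <= Num.sqrt d%:R * enorm x.
Proof.
rewrite -(ler_pXn2r (n := 2)) ?nnegrE ?sumr_ge0//; last first.
  by rewrite mulr_ge0 ?sqrtr_ge0.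
rewrite exprMn sqr_sqrtr// enorm_sqr dotpp_sum.
pose S := \sum_i `|x ord0 i|.
have : 0 <= \sum_(i < d) (d%:R * `|x ord0 i| - S) ^+ 2.
  by apply: sumr_ge0 => i _; rewrite sqr_ge0.
have -> : \sum_(i < d) (d%:R * `|x ord0 i| - S) ^+ 2 =
    d%:R * (d%:R * (\sum_i x ord0 i ^+ 2) - S ^+ 2).
  under eq_bigr do rewrite sqrrB.
  rewrite big_split/= sumrB sumr_const card_ord -[S ^+ 2 *+ d]mulr_natl.
  have -> : \sum_(i < d) (d%:R * `|x ord0 i|) ^+ 2 =
            d%:R ^+ 2 * \sum_i x ord0 i ^+ 2.
    rewrite mulr_sumr; apply: eq_bigr => i _.
    by rewrite exprMn real_normK ?num_real.
  have -> : \sum_(i < d) (d%:R * `|x ord0 i| * S *+ 2) = d%:R * S ^+ 2 *+ 2.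
    by rewrite sumrMnl -mulr_suml -mulr_sumr expr2 mulrA.
  rewrite mulr2n; ring.
have [d0|d0] := posnP d.
  have noI (i : 'I_d) : False by have := ltn_ord i; rewrite [X in (_ < X)%N]d0.
  by rewrite !big1 ?expr0n ?mulr0// => i; case: (noI i).
by rewrite pmulr_rge0 ?ltr0n// subr_ge0.
Qed.

End instances.

Section separable.
Context {R : realType} {d : nat} (mu : R).
Hypothesis mu0 : 0 < mu.
Implicit Types (c x y : 'rV[R]_d).

Definition sum_sabs c x : R := \sum_i sabs mu (x ord0 i - c ord0 i).
Definition dsum_sabs c x : 'rV[R]_d := \row_i dsabs mu (x ord0 i - c ord0 i).

Lemma smooth_convex_sum_sabs c : smooth_convex (sum_sabs c) (dsum_sabs c).
Proof.
exists (2 * mu)^-1 => x y.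
have -> : sum_sabs c y - sum_sabs c x - dotp (dsum_sabs c x) (y - x) =
    \sum_i (sabs mu (y ord0 i - c ord0 i) - sabs mu (x ord0 i - c ord0 i) -
      dsabs mu (x ord0 i - c ord0 i) *
        ((y ord0 i - c ord0 i) - (x ord0 i - c ord0 i))).
  rewrite /sum_sabs /dotp -!sumrB; apply: eq_bigr => i _.
  by rewrite !mxE; ring.
rewrite sumr_ge0 => [|i _]; last exact: sabs_tangent.
rewrite dotpp_sum mulr_sumr; apply: ler_sum => i _.
rewrite (le_trans (sabs_smooth mu0 _ _))// mulrC !mxE.
by rewrite opprB addrA subrK.
Qed.

Lemma sum_sabs_lip c x y :
  `|sum_sabs c x - sum_sabs c y| <= Num.sqrt d%:R * enorm (x - y).
Proof.
apply: le_trans (ler_sum_norm_enorm _).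
rewrite /sum_sabs -sumrB (le_trans (ler_norm_sum _ _ _))//.
apply: ler_sum => i _; rewrite (le_trans (sabs_lip mu0 _ _))// !mxE.
by rewrite opprB addrA subrK.
Qed.

Lemma sum_sabs_min c y : sum_sabs c c <= sum_sabs c y.
Proof. by apply: ler_sum => i _; rewrite subrr sabs0_le. Qed.

Lemma sum_sabs_center c : sum_sabs c c = d%:R * (mu / 2).
Proof.
rewrite /sum_sabs; under eq_bigr do rewrite subrr sabs0.
by rewrite sumr_const card_ord mulr_natl.
Qed.

Lemma sum_sabs_ge c x : \sum_i `|x ord0 i - c ord0 i| <= sum_sabs c x.
Proof. by apply: ler_sum => i _; exact: normr_le_sabs. Qed.

Lemma measurable_sum_sabs c : measurable_fun setT (sum_sabs c).
Proof.
apply: measurable_sum => i.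
apply: (measurableT_comp (measurable_sabs mu)).
by apply: measurable_funB => //; exact: measurable_coord.
Qed.

End separable.

Section max_sabs.
Context {R : realType} {d : nat} (mu : R).
Hypothesis mu0 : 0 < mu.
Implicit Types (c x y : 'rV[R]_d) (s : seq 'I_d).

Fixpoint max_sabs c s x : R :=
  if s is i :: s' then smax mu (sabs mu (x ord0 i - c ord0 i)) (max_sabs c s' x)
  else 0.

Fixpoint dmax_sabs c s x : 'rV[R]_d :=
  if s is i :: s' then
    let w := smaxw mu (sabs mu (x ord0 i - c ord0 i)) (max_sabs c s' x) in
    (w * dsabs mu (x ord0 i - c ord0 i)) *: delta_mx ord0 i
      + (1 - w) *: dmax_sabs c s' x
  else 0.

Lemma max_sabs_lip c s x y :
  `|max_sabs c s x - max_sabs c s y| <= enorm (x - y).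
Proof.
elim: s => [|i s IH] /=; first by rewrite subrr normr0 enorm_ge0.
apply: smax_lip => //; apply: le_trans (ler_coord_enorm _ i).
rewrite (le_trans (sabs_lip mu0 _ _))// !mxE.
by rewrite opprB addrA subrK.
Qed.

Lemma smooth_convex_max_sabs c s : smooth_convex (max_sabs c s) (dmax_sabs c s).
Proof.
elim: s => [|i s [K HK]].
  by exists 0 => x y /=; rewrite dotp0l !subr0 mul0r lexx.
exists ((2 * mu)^-1 + `|K| + 4 / (4 * mu)) => x y.
have -> : dotp (dmax_sabs c (i :: s) x) (y - x) =
    smaxw mu (sabs mu (x ord0 i - c ord0 i)) (max_sabs c s x) *
      dsabs mu (x ord0 i - c ord0 i) * (y - x) ord0 i +
    (1 - smaxw mu (sabs mu (x ord0 i - c ord0 i)) (max_sabs c s x)) *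
      dotp (dmax_sabs c s x) (y - x).
  by rewrite /= dotpDl !dotpZl dotp_delta.
rewrite /=; set a := sabs mu (x ord0 i - _); set a' := sabs mu (y ord0 i - _).
set b := max_sabs c s x; set b' := max_sabs c s y; set w := smaxw mu a b.
have /andP[w0 w1] := smaxw_bound mu a b; rewrite -/w in w0 w1.
have yxi : (y - x) ord0 i = y ord0 i - c ord0 i - (x ord0 i - c ord0 i).
  by rewrite !mxE; ring.
set D := dsabs mu _; set N := dotp (y - x) (y - x).
have N0 : 0 <= N by exact: dotpp_ge0.
have yiN : (y - x) ord0 i ^+ 2 <= N.
  rewrite /N -enorm_sqr -real_normK ?num_real// lerXn2r ?nnegrE ?enorm_ge0//.
  exact: ler_coord_enorm.
have t1 := sabs_tangent mu0 (y ord0 i - c ord0 i) (x ord0 i - c ord0 i).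
have t2 := sabs_smooth mu0 (y ord0 i - c ord0 i) (x ord0 i - c ord0 i).
rewrite -yxi -/a -/a' -/D in t1 t2.
have /andP[h1 h2] := HK x y; rewrite -/b -/b' -/N in h1 h2.
have s1 := smax_tangent mu0 a b a' b'; have s2 := smax_smooth mu0 a b a' b'.
rewrite -/w in s1 s2.
set P := dotp _ _ in h1 h2 *.
have la : `|a' - a| <= enorm (y - x).
  rewrite (le_trans (sabs_lip mu0 _ _))//.
  by rewrite -yxi; exact: ler_coord_enorm.
have lb : `|b' - b| <= enorm (y - x) by exact: max_sabs_lip.
have lab : (a' - a - (b' - b)) ^+ 2 <= 4 * N.
  rewrite /N -enorm_sqr -real_normK ?num_real//.
  apply: (@le_trans _ _ ((2 * enorm (y - x)) ^+ 2)); last by rewrite exprMn; lra.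
  rewrite lerXn2r ?nnegrE ?mulr_ge0 ?enorm_ge0//.
  by rewrite (le_trans (ler_normB _ _))//; lra.
have m0 : 0 < (2 * mu)^-1 by rewrite invr_gt0 mulr_gt0.
have m1 : 0 < (4 * mu)^-1 by rewrite invr_gt0 mulr_gt0.
have e1 : (y - x) ord0 i ^+ 2 / (2 * mu) <= (2 * mu)^-1 * N.
  by rewrite mulrC ler_pM2l.
have e2 : K * N <= `|K| * N by rewrite ler_wpM2r ?ler_norm.
have e3 : (a' - a - (b' - b)) ^+ 2 / (4 * mu) <= 4 / (4 * mu) * N.
  by rewrite [leRHS]mulrAC ler_pM2r.
have k0 : 0 <= `|K| * N by rewrite mulr_ge0.
have k1 : 0 <= (2 * mu)^-1 * N by rewrite mulr_ge0// ltW.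
set Q := (2 * mu)^-1 * N in e1 k1 *; set Q' := `|K| * N in e2 k0 *.
have -> : ((2 * mu)^-1 + `|K| + 4 / (4 * mu)) * N = Q + Q' + 4 / (4 * mu) * N.
  by rewrite /Q /Q'; ring.
set V := (y - x) ord0 i in t1 t2 e1 *.
have w1' : 0 <= 1 - w by lra.
have A1 : 0 <= w * (a' - a - D * V) by exact: mulr_ge0.
have A2 : 0 <= (1 - w) * (b' - b - P) by exact: mulr_ge0.
have B1 : w * (a' - a - D * V) <= Q.
  rewrite (le_trans (ler_wpM2l w0 (le_trans t2 e1)))//.
  by rewrite ler_piMl.
have B2 : (1 - w) * (b' - b - P) <= Q'.
  rewrite (le_trans (ler_wpM2l w1' (le_trans h2 e2)))//.
  by rewrite ler_piMl//; lra.
set Q'' := 4 / (4 * mu) * N in e3 *.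
have B3 := le_trans s2 e3.
set S := smax mu a' b' - smax mu a b in s1 s2 B3 *.
apply/andP; split; lra.
Qed.

Lemma max_sabs_min c s y : max_sabs c s c <= max_sabs c s y.
Proof.
elim: s => //= i s IH; apply: smax_homo => //.
by rewrite subrr sabs0_le.
Qed.

Lemma max_sabs_center c s : max_sabs c s c <= (size s).+1%:R * mu.
Proof.
elim: s => [|i s IH] /=; first by rewrite mul1r ltW.
rewrite subrr sabs0// (le_trans (smax_le mu0 _ _))//.
rewrite -[(size s).+2]addn1 natrD mulrDl mul1r.
apply: lerD; last by have := mu0; lra.
rewrite ge_max IH andbT -[(size s).+1%:R]natr1 mulrDl mul1r.
have : 0 <= (size s)%:R * mu by rewrite mulr_ge0// ltW.
have := mu0; lra.
Qed.

Lemma max_sabs_ge c s x i : i \in s -> `|x ord0 i - c ord0 i| <= max_sabs c s x.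
Proof.
elim: s => //= j s IH; rewrite inE => /orP[/eqP ->|/IH h].
  by apply: le_trans (smax_gel mu0 _ _); exact: normr_le_sabs.
by apply: (le_trans h); exact: smax_ger.
Qed.

Lemma measurable_max_sabs c s : measurable_fun setT (max_sabs c s).
Proof.
elim: s => [|i s IH] /=; first exact: measurable_cst.
have mi : measurable_fun setT (fun x => sabs mu (x ord0 i - c ord0 i)).
  apply: (measurableT_comp (measurable_sabs mu)).
  by apply: measurable_funB => //; exact: measurable_coord.
apply: measurable_funM => //; apply: measurable_funD; first exact: measurable_funD.
apply: (measurableT_comp (measurable_sabs mu)).
exact: measurable_funB.
Qed.

Lemma measurable_dmax_sabs c s : measurable_fun setT (dmax_sabs c s).
Proof.
elim: s => [|i s IH] /=; first exact: measurable_cst.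
have mc : measurable_fun setT (fun x => x ord0 i - c ord0 i).
  by apply: measurable_funB => //; exact: measurable_coord.
have mw : measurable_fun setT
    (fun x => smaxw mu (sabs mu (x ord0 i - c ord0 i)) (max_sabs c s x)).
  apply: measurable_funM => //; apply: measurable_funD => //.
  apply: (measurableT_comp (measurable_dsabs mu)).
  apply: measurable_funB; last exact: measurable_max_sabs.
  exact: (measurableT_comp (measurable_sabs mu)).
apply/measurable_rVP => j.
rewrite (_ : (fun x => _) = (fun x =>
  (smaxw mu (sabs mu (x ord0 i - c ord0 i)) (max_sabs c s x) *
    dsabs mu (x ord0 i - c ord0 i)) * delta_mx ord0 i (ord0 : 'I_1) j +
  (1 - smaxw mu (sabs mu (x ord0 i - c ord0 i)) (max_sabs c s x)) *
    dmax_sabs c s x ord0 j)); last first.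
  by apply/funext => x; rewrite mxE [X in X + _]mxE [X in _ + X]mxE.
apply: measurable_funD.
  apply: measurable_funM => //; apply: measurable_funM => //.
  exact: (measurableT_comp (measurable_dsabs mu)).
apply: measurable_funM; first exact: measurable_funB.
by move/measurable_rVP: IH.
Qed.

Definition no_kink c s x :=
  forall i j, i \in s -> j \in s ->
    2 * mu <= `|(x ord0 i - c ord0 i) + (x ord0 j - c ord0 j)| /\
    (i != j -> mu <= `|(x ord0 i - c ord0 i) - (x ord0 j - c ord0 j)|).

(* This is what limits the information in an exact gradient: away from the
   kinks it is one of [2 d + 1] vectors. *)
Lemma dmax_sabs_no_kink c s x : uniq s -> no_kink c s x ->
  (s = [::] \/ exists2 i, i \in s & max_sabs c s x = `|x ord0 i - c ord0 i|) /\
  (dmax_sabs c s x = 0 \/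
   exists i (b : bool), dmax_sabs c s x = (-1) ^+ b *: delta_mx ord0 i).
Proof.
elim: s => [|i s IH]; first by move=> _ _; split; left.
rewrite cons_uniq => /andP[iNs us] nk.
have [|IH1 IH2] := IH us.
  by move=> j k js ks; apply: nk; rewrite inE ?js ?ks orbT.
set a := x ord0 i - c ord0 i.
have [aa _] := nk i i (mem_head _ _) (mem_head _ _).
have amu : mu <= `|a|.
  move: aa; rewrite -/a (_ : a + a = 2 * a); last by lra.
  by rewrite normrM ger0_norm// ler_pM2l.
have sa : sabs mu a = `|a| by exact: sabsE.
have da : exists b : bool, dsabs mu a = (-1) ^+ b.
  have [a0|a0] := leP 0 a.
    by exists false; rewrite dsabs_ge//; rewrite ger0_norm in amu.
  by exists true; rewrite dsabs_le// -lerNr; rewrite ltr0_norm in amu.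
have gap : mu <= sabs mu a - max_sabs c s x \/
    (mu <= max_sabs c s x - sabs mu a /\ s <> [::]).
  rewrite sa; case: IH1 => [->|[j js ->]]; first by left; rewrite subr0.
  have ij : i != j by apply: contraNneq iNs => ->.
  have jis : j \in i :: s by rewrite inE js orbT.
  have [n1 /(_ ij)] := nk i j (mem_head _ _) jis.
  rewrite -/a; set b := x ord0 j - c ord0 j in n1 *.
  have sN : s <> [::] by move=> s0; rewrite s0 in js.
  rewrite -/a -/b in n1.
  move: n1; case: (ger0P a); case: (ger0P b); case: (ger0P (a + b));
  case: (ger0P (a - b)) => *;
  first [left; lra | right; split => //; lra | exfalso; lra].
rewrite /= -/a; case: gap => [g|[g sN]].
  have [-> ->] := smax_left mu0 g; split.
    by right; exists i; rewrite ?mem_head// sa.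
  case: da => b ->; right; exists i, b.
  by rewrite mul1r subrr scale0r addr0.
have [-> ->] := smax_right mu0 g; split.
  case: IH1 => // -[j js e]; right; exists j => //.
  by rewrite inE js orbT.
by rewrite mul0r scale0r add0r subr0 scale1r.
Qed.

End max_sabs.

(** * The dimension term *)

Section transcripts.
Context {R : realType} {d : nat} {Sig : finType} (e : Sig -> 'rV[R]_d).

Fixpoint tree_sum (n t : nat) (F : forall t, t.-tuple 'rV[R]_d -> R)
    (h : t.-tuple 'rV[R]_d) : R :=
  F t h + (if n is n'.+1 then
             \sum_a tree_sum n' F [tuple of rcons h (e a)] else 0).

Lemma tree_sum_ge0 n t F (h : t.-tuple 'rV[R]_d) :
  (forall t h, 0 <= F t h) -> 0 <= tree_sum n F h.
Proof.
move=> F0; elim: n t h => [|n IH] t h /=; first by rewrite addr0.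
by rewrite addr_ge0// sumr_ge0.
Qed.

Lemma tree_sum_le n t F (h : t.-tuple 'rV[R]_d) (B : R) : 0 <= B ->
  (forall t h, F t h <= B) -> tree_sum n F h <= #|Sig|.+1%:R ^+ n * B.
Proof.
move=> B0 FB; elim: n t h => [|n IH] t h /=; first by rewrite addr0 mul1r.
rewrite exprS -mulrA -[X in X * _]natr1 mulrDl mul1r addrC lerD//.
  rewrite (le_trans (ler_sum _ (fun a _ => IH _ _)))//.
  by rewrite sumr_const mulr_natl.
apply: (le_trans (FB _ _)); rewrite ler_peMl// exprn_ege1//.
by rewrite ler1n.
Qed.

Lemma avg_tree_sum (J : finType) n t F (h : t.-tuple 'rV[R]_d) :
  avg (fun j : J => tree_sum n (F j) h) =
  tree_sum n (fun t h => avg (fun j => F j t h)) h.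
Proof.
elim: n t h => [|n IH] t h /=; rewrite avgD; congr (_ + _).
  by rewrite /avg big1 ?mulr0.
by rewrite avg_sum; apply: eq_bigr => a _; rewrite IH.
Qed.

(* A union bound over all transcripts: the tree does not depend on the hidden
   instance, even though [bad], [G] and the branch actually taken do. *)
Lemma run_value_tree (A : algorithm R d) (g : 'rV[R]_d -> 'rV[R]_d)
    (bad G : 'rV[R]_d -> R) n t (s : seed A) (h : t.-tuple 'rV[R]_d) :
  (forall x, 0 <= bad x) -> (forall x, 0 <= G x <= 1) ->
  (forall x, 1 <= bad x \/ exists a, g x = e a) ->
  run_value (fun _ : unit => g) G n s h <=
  tree_sum n (fun t h => G (@output _ _ A t (s, h)) + bad (@query _ _ A t (s, h))) h.
Proof.
move=> bad0 G01 ge.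
have G0 x : 0 <= G x by have /andP[] := G01 x.
have F0 t' h' : 0 <= G (@output _ _ A t' (s, h')) + bad (@query _ _ A t' (s, h')).
  by rewrite addr_ge0.
elim: n t h => [|n IH] t h /=.
  by case: ifP => _; rewrite addr0 ?lerDl ?addr_ge0.
case: ifP => _.
  by rewrite -addrA lerDl addr_ge0// sumr_ge0// => a _; exact: tree_sum_ge0.
have avg_unit (F : unit -> R) : avg F = F tt.
  rewrite /avg card_unit invr1 mul1r (bigD1 tt)//= big1 ?addr0//.
rewrite avg_unit; case: (ge (query (s, h))) => [b1|[a ->]].
  apply: (@le_trans _ _ 1).
    apply: (run_value_le1 tt) => x; by have /andP[] := G01 x.
  rewrite -addrA (le_trans b1)// [leRHS]addrCA lerDl addr_ge0// sumr_ge0// => a _.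
  exact: tree_sum_ge0.
rewrite (le_trans (IH _ _))// (bigD1 a)//= addrCA lerDl addr_ge0// sumr_ge0// => b _.
exact: tree_sum_ge0.
Qed.

End transcripts.

Section counting.
Context {R : realType}.

Lemma sum_pred_le1 (I : finType) (P : pred I) :
  (forall i j, P i -> P j -> i = j) -> \sum_i (P i)%:R <= 1 :> R.
Proof.
move=> uP; have [i Pi|P0] := pickP P; last first.
  by rewrite big1// => i _; rewrite P0.
rewrite (bigD1 i)//= Pi big1 ?addr0// => j ji.
by case: (boolP (P j)) => // Pj; rewrite (uP _ _ Pi Pj) eqxx in ji.
Qed.

Lemma ler1_dist_nat (p q : nat) : p != q -> 1 <= `|p%:R - q%:R| :> R.
Proof.
wlog pq : p q / (q < p)%N => [th|_].
  rewrite neq_ltn => /orP[] pq; last by rewrite th// neq_ltn pq orbT.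
  by rewrite distrC th// neq_ltn pq orbT.
by rewrite -natrB ?(ltnW pq)// normr_nat ler1n subn_gt0.
Qed.

Lemma sum_affine_le1 (N : nat) (al be m : R) : 2 * m <= `|be| ->
  \sum_(q < N) (`|al - q%:R * be| < m)%R%:R <= 1 :> R.
Proof.
move=> mb; apply: (@sum_pred_le1 _ (fun q : 'I_N => `|al - q%:R * be| < m)%R).
move=> p q hp hq; apply/val_inj => /=; apply/eqP.
apply: contraTT isT => pq.
have : `|(p%:R - q%:R) * be| < `|be|.
  apply: lt_le_trans mb.
  have -> : (p%:R - q%:R) * be = (al - q%:R * be) - (al - p%:R * be) by ring.
  by rewrite (le_lt_trans (ler_normB _ _))//; lra.
rewrite normrM.
by rewrite ltNge ler_peMl// ler1_dist_nat.
Qed.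

Lemma avg_agree (d k : nat) (b : 'I_d -> bool) : (k <= d)%N ->
  avg (fun v : {ffun 'I_d -> bool} =>
    [forall i : 'I_d, (i < k)%N ==> (v i == b i)]%:R) = 2^-1 ^+ k :> R.
Proof.
move=> kd.
pose F (i : 'I_d) (x : bool) : R := 2^-1 * ((i < k)%N ==> (x == b i))%:R.
rewrite /avg mulr_sumr.
rewrite (eq_bigr (fun v : {ffun 'I_d -> bool} => \prod_i F i (v i))); last first.
  move=> v _; rewrite big_split/= prodr_const card_ord card_ffun card_bool card_ord.
  rewrite natrX exprVn; congr (_ * _).
  case: (boolP [forall i : 'I_d, (i < k)%N ==> (v i == b i)]) => [/forallP h|/forallPn[i hi]].
    by rewrite big1// => i _; rewrite h.
  by rewrite (bigD1 i)//= (negbTE hi) mul0r.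
rewrite -bigA_distr_bigA/=.
rewrite (eq_bigr (fun i : 'I_d => if (i < k)%N then 2^-1 else 1)).
  by rewrite -big_mkcond/= -(big_ord_widen _ (fun=> 2^-1))// prodr_const card_ord.
move=> i _; rewrite big_bool /F; case: ifP => /= _; case: (b i) => /=; lra.
Qed.

End counting.

Definition sgnb {R : realType} (b : bool) : R := if b then 1 else -1.

Lemma exact_oracle_ISGO {R : realType} {d : nat} (sigma delta : R) f
    (g : 'rV[R]_d -> 'rV[R]_d) (mg : forall _ : unit, measurable_fun setT g) :
  (0 < d)%N -> 0 < sigma -> 0 < delta -> gradient f = g ->
  is_ISGO sigma delta f (unif_oracle tt mg).
Proof.
move=> d0 s0 dl0 fg; apply: unif_oracle_ISGO => [x j|x u _].
  by rewrite (avg_cst tt) fg.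
rewrite fg subrr dotp0l normr0 (avg_cst tt).
have -> : (sigma / Num.sqrt d%:R <= 0) = false.
  by apply/negbTE; rewrite -ltNge divr_gt0// sqrtr_gt0 ltr0n.
exact: ltW.
Qed.

Section chebyshev_instance.
Context {R : realType} {d : nat} (k N : nat) (L r tau mu : R).

(* The shift [q] moves every kink of the maximum, because the weights [i + 1]
   have nonzero sums and differences; a fixed query is thus close to a kink for
   few values of [q] only. *)
Definition shifted_center (v : {ffun 'I_d -> bool}) (q : 'I_N) : 'rV[R]_d :=
  \row_i if (i < k)%N then r * sgnb (v i) + q%:R * (tau * i.+1%:R) else 0.

Definition first_coords : seq 'I_d := [seq i : 'I_d <- enum 'I_d | (i < k)%N].

Definition max_instance v q x : R :=
  L * max_sabs mu (shifted_center v q) first_coords x.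

Definition max_gradient v q x : 'rV[R]_d :=
  L *: dmax_sabs mu (shifted_center v q) first_coords x.

Definition answer (a : option ('I_d * bool)) : 'rV[R]_d :=
  if a is Some (i, b) then L *: ((-1) ^+ b *: delta_mx ord0 i) else 0.

Definition kinked v q x : bool :=
  `[< ~ no_kink mu (shifted_center v q) first_coords x >].

Lemma mem_first_coords i : (i \in first_coords) = (i < k)%N.
Proof. by rewrite mem_filter mem_enum andbT. Qed.

Lemma uniq_first_coords : uniq first_coords.
Proof. by rewrite filter_uniq// enum_uniq. Qed.

Lemma size_first_coords : (size first_coords <= d)%N.
Proof. by rewrite size_filter (leq_trans (count_size _ _))// size_enum_ord. Qed.

Hypothesis mu0 : 0 < mu.

Lemma max_gradient_answer v q x :
  kinked v q x \/ exists a, max_gradient v q x = answer a.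
Proof.
have [/asboolP nk|] := boolP `[< no_kink mu (shifted_center v q) first_coords x >].
  right; rewrite /max_gradient.
  have [_ [->|[i [b ->]]]] := dmax_sabs_no_kink mu0 uniq_first_coords nk.
    by exists None; rewrite scaler0.
  by exists (Some (i, b)).
by move=> /asboolPn nk; left; apply/asboolP.
Qed.

Lemma sum_kinked v x : 0 < tau -> 2 * mu <= tau ->
  \sum_(q < N) (kinked v q x)%:R <= 2 * d%:R ^+ 2 :> R.
Proof.
move=> tau0 mutau.
pose B (i : 'I_d) : R := x ord0 i - r * sgnb (v i).
pose W (i : 'I_d) : R := tau * i.+1%:R.
pose b1 (q : nat) (i j : 'I_d) := (`|(B i + B j) - q%:R * (W i + W j)| < 2 * mu)%R.
pose b2 (q : nat) (i j : 'I_d) :=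
  (i != j) && (`|(B i - B j) - q%:R * (W i - W j)| < mu)%R.
have kb (q : 'I_N) : (kinked v q x)%:R <=
    \sum_(i < d) \sum_(j < d) ((b1 q i j)%:R + (b2 q i j)%:R) :> R.
  have [/existsP[i /existsP[j ij]]|nb] :=
      boolP [exists i, exists j, b1 q i j || b2 q i j].
    rewrite (bigD1 i)//= (bigD1 j)//= -addrA; apply: (@le_trans _ _ 1).
      by case: (kinked _ _ _).
    rewrite -[leLHS]addr0; apply: lerD.
      by case/orP: ij => ->; rewrite ?lerDl ?lerDr.
    apply: addr_ge0; last first.
      by apply: sumr_ge0 => l _; apply: sumr_ge0 => m _; rewrite addr_ge0.
    by apply: sumr_ge0 => m _; rewrite addr_ge0.
  have -> : kinked v q x = false.
    apply/negbTE/asboolPn => nnk; apply: nnk => i j; rewrite !mem_first_coords => ik jk.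
    have := nb; rewrite negb_exists => /forallP/(_ i); rewrite negb_exists.
    move=> /forallP/(_ j); rewrite negb_or negb_and -!leNgt !mxE ik jk.
    move=> /andP[h1 h2]; split.
      apply: (le_trans h1); rewrite le_eqVlt; apply/orP; left; apply/eqP.
      by congr (`|_|); rewrite /B /W; ring.
    move=> ij; rewrite ij/= in h2; apply: (le_trans h2).
    rewrite le_eqVlt; apply/orP; left; apply/eqP.
    by congr (`|_|); rewrite /B /W; ring.
  by apply: sumr_ge0 => i _; apply: sumr_ge0 => j _; rewrite addr_ge0.
apply: (le_trans (ler_sum _ (fun q _ => kb q))).
rewrite exchange_big/=.
have bnd (i j : 'I_d) :
    \sum_(q < N) ((b1 q i j)%:R + (b2 q i j)%:R) <= 2 :> R.
  rewrite big_split/= -[leRHS]/(1 + 1); apply: lerD.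
    rewrite /b1; apply: sum_affine_le1; rewrite /W -mulrDr normrM (gtr0_norm tau0).
    rewrite ger0_norm ?addr_ge0// (le_trans (ler_wpM2l _ mutau))// mulrC ler_pM2l//.
    by rewrite -natrD ler_nat addSn addnS.
  rewrite /b2; have [ij|ij] := eqVneq i j.
    by rewrite big1// => q _.
  apply: sum_affine_le1; apply: (le_trans mutau).
  rewrite /W -mulrBr normrM (gtr0_norm tau0) ler_peMr ?(ltW tau0)//.
  exact: ler1_dist_nat.
apply: (@le_trans _ _ (\sum_(i < d) \sum_(j < d) 2)); last first.
  by rewrite !sumr_const card_ord -mulrnA -[leLHS]mulr_natl natrM mulrC expr2.
apply: ler_sum => i _; rewrite exchange_big/=.
by apply: ler_sum => j _; exact: bnd.
Qed.

End chebyshev_instance.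

Lemma sum_pair {V : nmodType} {I K : finType} (F : I * K -> V) :
  \sum_p F p = \sum_i \sum_k F (i, k).
Proof. by rewrite pair_bigA/=; apply: eq_bigr => -[]. Qed.

Lemma avg_pair {R : realType} {I J : finType} (F : I * J -> R) :
  avg F = avg (fun i => avg (fun j => F (i, j))).
Proof.
by rewrite /avg -mulr_sumr mulrA -invfM -natrM -card_prod sum_pair.
Qed.

Section max_instance_bound.
Context {R : realType} {d : nat} (k N : nat) (L Rad eps zeta r tau mu : R).
Hypotheses (d0 : (0 < d)%N) (kd : (k <= d)%N) (N0 : (0 < N)%N).
Hypotheses (L0 : 0 < L) (Rad0 : 0 < Rad) (r0 : 0 < r) (tau0 : 0 < tau).
Hypotheses (mu0 : 0 < mu) (mutau : 2 * mu <= tau).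
Hypothesis tauN : N%:R * (tau * d%:R) <= zeta.
Hypothesis rzeta : k%:R * (r + zeta) ^+ 2 <= Rad ^+ 2.
Hypothesis gap : d.+1%:R * mu + eps / L < r - zeta.

Local Notation F v q := (@max_instance R d k N L r tau mu v q).
Local Notation g v q := (@max_gradient R d k N L r tau mu v q).
Local Notation c v q := (@shifted_center R d k N r tau v q).

Lemma max_instance_smooth v q : smooth_convex (F v q) (g v q).
Proof. by apply: smooth_convexZ (ltW L0) _; exact: smooth_convex_max_sabs. Qed.

Lemma max_instance_min v q y : F v q (c v q) <= F v q y.
Proof. by rewrite ler_pM2l// max_sabs_min. Qed.

Lemma shift_bound (q : 'I_N) (i : 'I_d) : 0 <= q%:R * (tau * i.+1%:R) <= zeta.
Proof.
rewrite !mulr_ge0 ?(ltW tau0)//=; apply: le_trans tauN.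
apply: ler_pM => //; first by rewrite mulr_ge0// ltW.
  by rewrite ler_nat ltnW.
by rewrite ler_pM2l// ler_nat.
Qed.

Lemma shifted_center_norm v q : enorm (c v q) <= Rad.
Proof.
rewrite -(ler_pXn2r (n := 2)) ?nnegrE ?enorm_ge0 ?(ltW Rad0)// enorm_sqr.
apply: le_trans rzeta; rewrite dotpp_sum.
rewrite (eq_bigr (fun i : 'I_d => if (i < k)%N then c v q ord0 i ^+ 2 else 0)); last first.
  by move=> i _; rewrite !mxE; case: ifP => // _; rewrite expr0n.
rewrite -big_mkcond/=.
apply: (@le_trans _ _ (\sum_(i < d | (i < k)%N) (r + zeta) ^+ 2)).
  apply: ler_sum => i ik; rewrite mxE ik.
  have := shift_bound q i; set z := _ * _ => z01.
  have := r0; rewrite -[leLHS]real_normK ?num_real// => r0'.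
  rewrite lerXn2r ?nnegrE//; first by lra.
  by rewrite ler_norml /sgnb; case: (v i); apply/andP; split; lra.
by rewrite -(big_ord_widen _ (fun=> (r + zeta) ^+ 2))// sumr_const card_ord mulr_natl.
Qed.

Lemma max_instance_sco v q : sco_instance L Rad (F v q).
Proof.
apply: (sco_instance_smooth (max_instance_smooth v q) (xstar := c v q)).
- move=> x y; rewrite -mulrBr normrM (gtr0_norm L0) ler_pM2l//.
  exact: max_sabs_lip.
- exact: max_instance_min.
- exact: shifted_center_norm.
Qed.

Lemma max_instance_sign v q x (i : 'I_d) : (i < k)%N ->
  eps_optimal eps (F v q) x -> v i = (0 < x ord0 i).
Proof.
move=> ik /(eps_optimal_le (max_instance_min v q)) xopt.
have h1 : `|x ord0 i - c v q ord0 i| <= d.+1%:R * mu + eps / L.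
  rewrite -(ler_pM2l L0); apply: (@le_trans _ _ (F v q x)).
    by rewrite ler_pM2l//; apply: max_sabs_ge; rewrite ?mem_first_coords.
  apply: (le_trans xopt); rewrite mulrDr [L * (eps / L)]mulrC divfK ?gt_eqF//.
  rewrite lerD2r ler_pM2l// (le_trans (max_sabs_center mu0 _ _))//.
  by rewrite ler_pM2r// ler_nat ltnS size_first_coords.
have := shift_bound q i; set z := _ * _ => z01.
move: h1; rewrite mxE ik -/z ler_norml => h1; have gap' := gap.
move: h1; rewrite /sgnb; case: (v i) => h1.
  by apply/esym; lra.
by apply/esym/negbTE; rewrite -leNgt; lra.
Qed.

Lemma measurable_max_gradient v q (_ : unit) : measurable_fun setT (g v q).
Proof.
apply/measurable_rVP => i.
rewrite (_ : (fun x => _) = (fun x =>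
    L * dmax_sabs mu (c v q) (first_coords k) x ord0 i)); last first.
  by apply/funext => x; rewrite mxE.
apply: measurable_funM => //.
by have /measurable_rVP := measurable_dmax_sabs mu (c v q) (@first_coords d k).
Qed.

Lemma measurable_max_instance v q : measurable_fun setT (F v q).
Proof. by apply: measurable_funM => //; exact: measurable_max_sabs. Qed.

Lemma max_instance_bound (A : algorithm R d) (T : nat) (p : R) :
  (forall v q, (p%:E <= success_probability A
     (unif_oracle tt (measurable_max_gradient v q)) (eps_optimal eps (F v q)) T)%E) ->
  p <= (2 * d + 2)%:R ^+ T * (2^-1 ^+ k + 2 * d%:R ^+ 2 / N%:R).
Proof.
move=> Hp.
pose q0 : 'I_N := Ordinal N0.
pose v0 : {ffun 'I_d -> bool} := [ffun=> true].
pose J := ({ffun 'I_d -> bool} * 'I_N)%type.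
apply: (@avg_success_probability R d unit J tt (v0, q0)
  (fun j _ => g j.1 j.2) (fun j => measurable_max_gradient j.1 j.2) A
  (fun j => eps_optimal eps (F j.1 j.2)) T p) => [j|j|s].
- by apply: measurable_eps_optimal; exact: measurable_max_instance.
- exact: Hp.
set B := 2^-1 ^+ k + _.
have B0 : 0 <= B by rewrite addr_ge0 ?exprn_ge0 ?mulr_ge0 ?invr_ge0 ?exprn_ge0.
pose bad (j : J) x : R := (@kinked R d k N r tau mu j.1 j.2 x)%:R.
pose Fj (j : J) (t : nat) (h : t.-tuple 'rV[R]_d) : R :=
  \1_(eps_optimal eps (F j.1 j.2)) (@output _ _ A t (s, h)) +
  bad j (@query _ _ A t (s, h)).
apply: (@le_trans _ _ (avg (fun j => tree_sum (@answer R d L) T (Fj j) [tuple]))).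
  apply: ler_avg => j; apply: run_value_tree.
  - by move=> x; rewrite /bad.
  - by move=> x; rewrite indicE; case: (_ \in _); rewrite ?lexx ler01.
  - move=> x; rewrite /bad.
    by case: (@max_gradient_answer R d k N L r tau mu mu0 j.1 j.2 x) => [->|]; [left|right].
rewrite avg_tree_sum.
have -> : (2 * d + 2)%N = #|{: option ('I_d * bool)}|.+1.
  by rewrite card_option card_prod card_ord card_bool mulnC addnS addn1.
apply: tree_sum_le => // t h.
rewrite /Fj avgD; apply: lerD.
  set x := output _.
  rewrite avg_pair.
  apply: (@le_trans _ _ (avg (fun v : {ffun 'I_d -> bool} =>
    [forall i : 'I_d, (i < k)%N ==> (v i == (0 < x ord0 i))]%:R)));
    last by rewrite avg_agree.
  apply: ler_avg => v; rewrite -[leRHS](avg_cst q0); apply: ler_avg => q.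
  rewrite indicE; case: (boolP (_ \in _)) => [/set_mem/= xo|_]; last exact: ler0n.
  rewrite (_ : [forall i, _] = true)//; apply/forallP => i; apply/implyP => ik.
  by rewrite (max_instance_sign ik xo).
set x := query _.
rewrite avg_pair -(avg_cst v0 (2 * d%:R ^+ 2 / N%:R)); apply: ler_avg => v.
rewrite /avg card_ord mulrC ler_pM2r ?invr_gt0 ?ltr0n//.
exact: sum_kinked.
Qed.

End max_instance_bound.

Section dimension_term.
Context {R : realType}.

Lemma ler_of_inv_nat (x y z : R) :
  (forall N, (0 < N)%N -> x <= y + z / N%:R) -> x <= y.
Proof.
move=> h; rewrite leNgt; apply/negP => yx.
have [z0|z0] := leP z 0.
  have := h 1%N isT; rewrite divr1; lra.
pose N := (Num.truncn (z / (x - y))).+1.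
have N0 : 0 < N%:R :> R by rewrite ltr0n.
have zN : z / (x - y) < N%:R.
  by have /andP[] : (N.-1%:R <= z / (x - y) < N%:R) by
    apply: truncn_itv; rewrite divr_ge0 ?subr_ge0// ltW.
have := h N isT; apply/negP; rewrite -ltNge -ltrBrDl.
by rewrite ltr_pdivrMr// mulrC -ltr_pdivrMr ?subr_gt0.
Qed.

Lemma solves_SCO_transcripts (d k : nat) (L Rad eps sigma delta p : R)
    (A : algorithm R d) (T : nat) :
  (0 < k)%N -> (k <= d)%N -> 0 < L -> 0 < Rad -> 0 < sigma -> 0 < delta ->
  0 < eps -> eps * Num.sqrt k%:R < L * Rad ->
  solves_SCO A T L Rad eps sigma delta p ->
  p * 2 ^+ k <= (2 * d + 2)%:R ^+ T.
Proof.
move=> k0 kd L0 Rad0 s0 dl0 e0 ekLR solves.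
have d0 : (0 < d)%N by exact: leq_trans kd.
have dR0 : 0 < d%:R :> R by rewrite ltr0n.
have sk0 : 0 < Num.sqrt k%:R :> R by rewrite sqrtr_gt0 ltr0n.
pose Rk := Rad / Num.sqrt k%:R.
have eRk : eps / L < Rk.
  by rewrite ltr_pdivrMr// mulrAC ltr_pdivlMr// [Rad * L]mulrC.
have eL0 : 0 < eps / L by rewrite divr_gt0.
pose rho := Rk - eps / L; have rho0 : 0 < rho by rewrite subr_gt0.
pose zeta := rho / 4; pose r := Rk - zeta.
have zeta0 : 0 < zeta by rewrite divr_gt0.
have r0 : 0 < r by rewrite /r /zeta; rewrite /rho in rho0 *; lra.
have rzeta : k%:R * (r + zeta) ^+ 2 <= Rad ^+ 2.
  rewrite /r subrK /Rk exprMn exprVn sqr_sqrtr//.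
  by rewrite mulrCA divff ?mulr1// pnatr_eq0 -lt0n.
rewrite -ler_pdivlMr ?exprn_gt0// -exprVn.
apply: (@ler_of_inv_nat _ _ ((2 * d + 2)%:R ^+ T * (2 * d%:R ^+ 2))) => N N0.
have NR0 : 0 < N%:R :> R by rewrite ltr0n.
pose tau := zeta / (N%:R * d%:R).
have tau0 : 0 < tau by rewrite divr_gt0// mulr_gt0.
pose mu := Num.min (tau / 2) (rho / (4 * d.+1%:R)).
have mu0 : 0 < mu by rewrite lt_min !divr_gt0// mulr_gt0// ltr0n.
have mutau : 2 * mu <= tau.
  by rewrite mulrC -ler_pdivlMr// ge_min lexx.
have tauN : N%:R * (tau * d%:R) <= zeta.
  by rewrite mulrCA [N%:R * _]mulrC /tau [d%:R * _]mulrC divfK// gt_eqF ?mulr_gt0.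
have gap : d.+1%:R * mu + eps / L < r - zeta.
  have : d.+1%:R * mu <= rho / 4.
    rewrite mulrC -ler_pdivlMr ?ltr0n// -mulrA -invfM.
    by rewrite ge_min lexx orbT.
  rewrite /r /zeta; rewrite /rho in rho0 *; lra.
rewrite -mulrA -mulrDr.
apply: (max_instance_bound kd N0 L0 tau0 mu0 mutau tauN gap (A := A)) => v q.
apply: solves.
  exact: (max_instance_sco kd L0 Rad0 r0 tau0 mu0 tauN rzeta).
apply: exact_oracle_ISGO => //.
exact/smooth_convex_gradient/max_instance_smooth.
Qed.

Lemma dimension_term_bound (a : R) (d : nat) (L Rad eps sigma delta : R)
    (A : algorithm R d) (T : nat) :
  0 < a -> a < 1 ->
  (0 < d)%N -> 0 < L -> 0 < Rad -> 0 < sigma -> 0 < delta ->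
  0 < eps -> eps <= a * (L * Rad) ->
  solves_SCO A T L Rad eps sigma delta (2 / 3) ->
  a * ln (4 / 3) / 6 * Num.min (Rad ^+ 2 * L ^+ 2 / eps ^+ 2) d%:R
    <= T%:R * (1 + ln d%:R).
Proof.
move=> a0 a1 d0 L0 Rad0 s0 dl0 e0 eps_le solves.
pose Y := Rad ^+ 2 * L ^+ 2 / eps ^+ 2.
have LR0 : 0 < L * Rad by rewrite mulr_gt0.
have aY1 : 1 <= a * Y.
  rewrite /Y mulrA ler_pdivlMr ?exprn_gt0// mul1r.
  apply: (@le_trans _ _ ((a * (L * Rad)) ^+ 2)).
    by rewrite lerXn2r ?nnegrE ?(ltW e0)// mulr_ge0 ?(ltW a0) ?(ltW LR0).
  rewrite exprMn expr2 -mulrA ler_pM2l// exprMn [_ ^+ 2 * _ ^+ 2]mulrC.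
  by rewrite ler_piMl ?mulr_ge0 ?exprn_ge0 ?ltW.
have Y0 : 0 < Y by rewrite divr_gt0 ?mulr_gt0 ?exprn_gt0.
have aY0 : 0 <= a * Y by rewrite (le_trans _ aY1).
pose m := Num.truncn (a * Y); pose k := minn d m.
have /andP[m1 m2] := truncn_itv aY0; rewrite -/m in m1 m2.
have m0 : (0 < m)%N by rewrite truncn_gt0.
have k0 : (0 < k)%N by rewrite leq_min d0.
have kY : k%:R <= a * Y by rewrite (le_trans _ m1)// ler_nat geq_minr.
have ekLR : eps * Num.sqrt k%:R < L * Rad.
  rewrite -(ltr_pXn2r (n := 2)) ?nnegrE ?mulr_ge0 ?sqrtr_ge0 ?ltW//.
  rewrite exprMn sqr_sqrtr//.
  apply: (@le_lt_trans _ _ (eps ^+ 2 * (a * Y))).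
    by rewrite ler_pM2l ?exprn_gt0.
  have -> : eps ^+ 2 * (a * Y) = a * (L * Rad) ^+ 2.
    by rewrite mulrCA; congr (_ * _); rewrite /Y mulrC divfK ?gt_eqF ?exprn_gt0// exprMn mulrC.
  by rewrite gtr_pMl ?exprn_gt0.
have kd : (k <= d)%N by exact: geq_minl.
have := solves_SCO_transcripts k0 kd L0 Rad0 s0 dl0 e0 ekLR solves.
have dR1 : 1 <= d%:R :> R by rewrite ler1n.
have lnd0 : 0 <= ln d%:R :> R by exact: ln_ge0.
have l43 : 0 < ln (4 / 3) :> R by rewrite ln_gt0//; lra.
move=> htr.
have pow_le : (4 / 3) ^+ k <= 2 / 3 * 2 ^+ k :> R.
  rewrite -(prednK k0); elim: k.-1 => [|j IH]; first by rewrite !expr1; lra.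
  rewrite exprS [2 ^+ j.+2]exprS mulrCA.
  by apply: ler_pM => //; lra.
have lnX : ln (2 * d + 2)%:R <= 3 * (1 + ln d%:R) :> R.
  apply: (@le_trans _ _ (ln (4 * d%:R))).
    rewrite ler_ln ?posrE ?ltr0n ?mulr_gt0 ?ltr0n ?addn_gt0 ?orbT//.
    by rewrite natrD natrM; lra.
  rewrite lnM ?posrE ?ltr0n//.
  have : ln (1 + 3) <= 3 :> R by apply: le_ln1Dx; lra.
  have -> : (1 + 3 = 4 :> R) by lra.
  lra.
have kT : k%:R * ln (4 / 3) <= T%:R * (3 * (1 + ln d%:R)) :> R.
  apply: (@le_trans _ _ (T%:R * ln (2 * d + 2)%:R)); last by rewrite ler_wpM2l.
  rewrite [k%:R * _]mulr_natl [T%:R * _]mulr_natl -!lnXn ?ltr0n ?addn_gt0 ?orbT//; try lra.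
  rewrite ler_ln ?posrE ?exprn_gt0 ?ltr0n ?addn_gt0 ?orbT//; try lra.
have kmin : a / 2 * Num.min Y d%:R <= k%:R.
  have mY : Num.min Y d%:R <= Y by rewrite ge_min lexx.
  have md : Num.min Y d%:R <= d%:R by rewrite ge_min lexx orbT.
  have [dm|md'] := leqP d m; rewrite /k.
    rewrite (minn_idPl dm); nra.
  rewrite (minn_idPr (ltnW md')).
  have : 1 <= m%:R :> R by rewrite ler1n.
  rewrite -natr1 in m2.
  have : a * Num.min Y d%:R <= a * Y by rewrite ler_pM2l.
  lra.
have : a / 2 * Num.min Y d%:R * ln (4 / 3) <= k%:R * ln (4 / 3).
  by rewrite ler_pM2r.
rewrite -/Y; lra.
Qed.

End dimension_term.

(** * Rademacher sums *)

Section signs.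
Context {R : realType} {J : finType}.
Local Notation Om := {ffun J -> bool}.
Implicit Types (w : Om) (F f g : Om -> R).

Lemma sgnbN b : sgnb (~~ b) = - sgnb b :> R.
Proof. by case: b; rewrite /sgnb ?opprK. Qed.

Lemma sgnb_sqr b : sgnb b ^+ 2 = 1 :> R.
Proof. by case: b; rewrite /sgnb ?sqrrN expr1n. Qed.

Lemma normr_sgnb b : `|sgnb b| = 1 :> R.
Proof. by case: b; rewrite /sgnb ?normrN normr1. Qed.

Definition flip (j : J) w : Om := [ffun i => if i == j then ~~ w i else w i].
Definition put (j : J) (s : bool) w : Om := [ffun i => if i == j then s else w i].

Lemma flipK j : involutive (flip j).
Proof. by move=> w; apply/ffunP => i; rewrite !ffunE; case: eqP => //; rewrite negbK. Qed.

Lemma avg_put j s F :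
  avg (fun w => F (put j s w)) = avg (fun w => (1 + sgnb s * sgnb (w j)) * F w).
Proof.
have h : avg (fun w => (1 + sgnb s * sgnb (w j)) * F w) =
    2^-1 * avg (fun w => (1 + sgnb s * sgnb (w j)) * F w +
      (1 + sgnb s * sgnb (flip j w j)) * F (flip j w)).
  rewrite avgD.
  rewrite (reindex_avg (fun w => (1 + sgnb s * sgnb (flip j w j)) * F (flip j w))
    (flipK j)).
  rewrite /= (eq_avg (G := fun w => (1 + sgnb s * sgnb (w j)) * F w)); first lra.
  by move=> w /=; rewrite flipK.
rewrite h {h} -avgZ; apply: eq_avg => w.
have -> : put j s w = if w j == s then w else flip j w.
  apply/ffunP => i; case: ifPn => [/eqP <-|ws]; rewrite !ffunE; case: eqP => // ->//.
  by move: ws; case: (w j); case: s.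
rewrite ffunE eqxx sgnbN; case: (w j); case: s => /=; rewrite /sgnb; lra.
Qed.

Lemma avg_sgnb_neq j j' : j != j' -> avg (fun w => sgnb (w j) * sgnb (w j')) = 0 :> R.
Proof.
move=> jj'; have e := reindex_avg (fun w => sgnb (w j) * sgnb (w j') : R) (flipK j).
have : avg (fun w => sgnb (w j) * sgnb (w j')) =
       - avg (fun w => sgnb (w j) * sgnb (w j')) :> R.
  rewrite {1}e -mulN1r -avgZ; apply: eq_avg => w /=.
  by rewrite !ffunE eqxx eq_sym (negbTE jj') sgnbN mulN1r mulNr.
lra.
Qed.

Definition mix (a : pred J) w w' : Om := [ffun j => if a j then w j else w' j].

Lemma avg_indep (a : pred J) f g :
  (forall w w', (forall j, a j -> w j = w' j) -> f w = f w') ->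
  (forall w w', (forall j, ~~ a j -> w j = w' j) -> g w = g w') ->
  avg (fun w => f w * g w) = avg f * avg g.
Proof.
move=> fa ga; pose w0 : Om := [ffun=> true].
have -> : avg f * avg g = avg (fun p : Om * Om => f p.1 * g p.2).
  rewrite avg_pair/= mulrC -avgZ; apply: eq_avg => w.
  by rewrite avgZ mulrC.
pose sw (p : Om * Om) := (mix a p.1 p.2, mix a p.2 p.1).
have swK : involutive sw.
  move=> [w w']; rewrite /sw/=.
  by congr (_, _); apply/ffunP => j; rewrite !ffunE; case: (a j).
rewrite (reindex_avg _ swK) avg_pair; apply: eq_avg => w.
rewrite -[LHS](avg_cst w0); apply: eq_avg => w' /=; congr (_ * _).
  by apply: fa => j aj; rewrite ffunE aj.
by apply: ga => j aj; rewrite ffunE (negbTE aj).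
Qed.

Definition permute (s : J -> J) w : Om := [ffun j => w (s j)].

Lemma permuteK s : involutive s -> involutive (permute s).
Proof. by move=> sK w; apply/ffunP => j; rewrite !ffunE sK. Qed.

Lemma avg_prod (F : J -> bool -> R) :
  avg (fun w => \prod_j F j (w j)) = \prod_j (2^-1 * (F j true + F j false)).
Proof.
rewrite big_split/= prodr_const exprVn /avg card_ffun card_bool natrX.
by congr (_ * _); rewrite -bigA_distr_bigA/=; apply: eq_bigr => j _; rewrite big_bool.
Qed.

End signs.

Section rademacher_tail.
Context {R : realType}.

Lemma expR_cosh (x : R) : `|x| <= 2^-1 ->
  2^-1 * (expR x + expR (- x)) <= expR (2 * x ^+ 2).
Proof.
rewrite ler_norml => xb.
have eb (y : R) : y < 1 -> expR y <= (1 - y)^-1.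
  move=> y1; rewrite -[expR y]invrK -expRN lef_pV2 ?posrE ?expR_gt0 ?subr_gt0//.
  exact: expR_ge1Dx.
have e1 := eb x; have e2 := eb (- x); rewrite opprK in e2.
apply: (le_trans _ (expR_ge1Dx _)).
have x2 : x ^+ 2 <= 2^-1 by nra.
have p1 : 0 < 1 - x by lra. have p2 : 0 < 1 + x by lra.
apply: (@le_trans _ _ (2^-1 * ((1 - x)^-1 + (1 + x)^-1))).
  by rewrite ler_wpM2l ?invr_ge0// lerD ?e1 ?e2//; lra.
have -> : 2^-1 * ((1 - x)^-1 + (1 + x)^-1) = (1 - x ^+ 2)^-1.
  by field; rewrite !gt_eqF//; nra.
rewrite -[leLHS]mul1r ler_pdivrMr; last by lra.
have := sqr_ge0 x; set y := x ^+ 2 in x2 *; nra.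
Qed.

Lemma rademacher_tail {J : finType} (c : J -> R) (S lam : R) :
  0 < S -> \sum_j c j ^+ 2 <= S ^+ 2 ->
  avg (fun w : {ffun J -> bool} =>
    (lam * S <= `|\sum_j c j * sgnb (w j)|)%R%:R) <= expR (3 / 2 - lam / 2).
Proof.
move=> S0 cS; pose th := (2 * S)^-1.
have th0 : 0 < th by rewrite invr_gt0 mulr_gt0.
pose X (w : {ffun J -> bool}) : R := \sum_j c j * sgnb (w j).
have cj j : `|th * c j| <= 2^-1.
  have : c j ^+ 2 <= S ^+ 2.
    by apply: le_trans cS; rewrite (bigD1 j)//= lerDl sumr_ge0// => i _; exact: sqr_ge0.
  rewrite -real_normK ?num_real// ler_pXn2r ?nnegrE ?(ltW S0)// => h.
  by rewrite normrM gtr0_norm// /th invfM -mulrA ler_piMr ?invr_ge0// mulrC ler_pdivrMr ?mul1r.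
have mgf (s : bool) : avg (fun w => expR (sgnb s * th * X w)) <= expR (1 / 2).
  have -> : avg (fun w => expR (sgnb s * th * X w)) =
      avg (fun w : {ffun J -> bool} => \prod_j expR (sgnb s * th * c j * sgnb (w j))).
    apply: eq_avg => w; rewrite -expR_sum; congr expR.
    by rewrite /X mulr_sumr; apply: eq_bigr => j _; rewrite mulrA.
  rewrite (avg_prod (fun j b => expR (sgnb s * th * c j * sgnb b))).
  apply: (@le_trans _ _ (\prod_j expR (2 * (th * c j) ^+ 2))).
    apply: ler_prod => j _; rewrite mulr_ge0 ?invr_ge0 ?addr_ge0 ?expR_ge0//=.
    have := expR_cosh (cj j).
    by rewrite /sgnb; case: s; rewrite ?mul1r ?mulN1r ?mulNr ?mulr1 ?mulrN1 ?opprK// addrC.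
  rewrite -expR_sum ler_expR -mulr_sumr.
  under eq_bigr do rewrite exprMn.
  rewrite -mulr_sumr /th.
  apply: (@le_trans _ _ (2 * ((2 * S)^-1 ^+ 2 * S ^+ 2))).
    by rewrite ler_wpM2l// ler_wpM2l// exprn_ge0// ltW.
  rewrite le_eqVlt; apply/orP; left; apply/eqP; field.
  by rewrite gt_eqF.
have pt (w : {ffun J -> bool}) : (lam * S <= `|X w|)%R%:R <=
    expR (- (lam / 2)) * (expR (sgnb true * th * X w) + expR (sgnb false * th * X w)).
  have pos : 0 <= expR (- (lam / 2)) *
      (expR (sgnb true * th * X w) + expR (sgnb false * th * X w)).
    by rewrite mulr_ge0 ?addr_ge0 ?expR_ge0.
  case: (boolP (lam * S <= `|X w|)) => // h; rewrite mulrDr -!expRD.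
  have thX : lam / 2 <= th * `|X w|.
    rewrite /th invfM mulrAC -[lam / 2]mulr1 [_ / 2 * 1]mulrC.
    rewrite mul1r -mulrA mulrC ler_pM2l// ler_pdivlMr//.
  have [X0|X0] := leP 0 (X w).
    rewrite ger0_norm// in thX; rewrite /sgnb mul1r.
    rewrite -[leLHS]addr0; apply: lerD; last exact: expR_ge0.
    rewrite /= -[leLHS]expR0 ler_expR; lra.
  rewrite ltr0_norm// in thX; rewrite /sgnb mulN1r addrC.
  rewrite -[leLHS]addr0; apply: lerD; last exact: expR_ge0.
    rewrite /= -[leLHS]expR0 ler_expR; lra.
apply: (le_trans (ler_avg pt)); rewrite avgZ avgD.
apply: (@le_trans _ _ (expR (- (lam / 2)) * (expR (1 / 2) * 2))).
  by rewrite ler_wpM2l ?expR_ge0// mulr2n mulrDr mulr1 lerD// ?mgf.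
apply: (@le_trans _ _ (expR (- (lam / 2)) * (expR (1 / 2) * expR 1))).
  by rewrite ler_wpM2l ?expR_ge0// ler_wpM2l ?expR_ge0// expR_ge1Dx.
by rewrite -!expRD ler_expR; lra.
Qed.

End rademacher_tail.

Section small_ball.
Context {R : realType} {J : finType}.
Variables (c : J -> R) (a : pred J) (s : J -> J).
Hypotheses (sK : involutive s) (cs : forall j, c (s j) = c j).
Hypothesis asP : forall j, c j != 0 -> a (s j) = ~~ a j.
Local Notation Om := {ffun J -> bool}.

Let X (w : Om) : R := \sum_j c j * sgnb (w j).
Let half (w : Om) : R := \sum_(j | a j) c j * sgnb (w j).
Let opp (w : Om) : Om := [ffun j => ~~ w (s j)].

Let oppK : involutive opp.
Proof. by move=> w; apply/ffunP => j; rewrite !ffunE sK negbK. Qed.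

Let split_half w : X w = half w - half (opp w).
Proof.
rewrite /X (bigID a)/=; congr (_ + _).
rewrite /half [in RHS](reindex_inj (inv_inj sK))/= -sumrN.
rewrite big_mkcond [RHS]big_mkcond/=; apply: eq_bigr => j _.
rewrite ffunE sK cs sgnbN mulrN opprK.
have [->|cj] := eqVneq (c j) 0; first by rewrite mul0r !if_same.
by rewrite asP.
Qed.

(* Pigeonhole: [X] is the difference of two independent copies of [half], which
   fall into a common bin of width [wd] with probability at least the inverse
   of the number of bins. *)
Lemma avg_small_ball (S wd : R) : 0 < S -> 0 < wd -> \sum_j c j ^+ 2 <= S ^+ 2 ->
  (4 * (10 * S / wd + 1))^-1 <= avg (fun w : Om => (`|X w| < wd)%R%:R).
Proof.
move=> S0 wd0 cS; pose w0 : Om := [ffun=> true].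
have Swd0 : 0 <= 10 * S / wd by rewrite divr_ge0 ?mulr_ge0// ltW.
pose N := (Num.truncn (10 * S / wd)).+1.
pose bin (j : 'I_N) (w : Om) : R :=
  ((`|half w| < 5 * S) && (Num.truncn ((half w + 5 * S) / wd) == j))%R%:R.
pose p j := avg (bin j).
have shift0 w : `|half w| < 5 * S -> 0 <= (half w + 5 * S) / wd.
  by rewrite ltr_norml => h; apply: divr_ge0; lra.
have pair w : \sum_j bin j w * bin j (opp w) <= (`|X w| < wd)%R%:R.
  have [/existsP[j /andP[j1 j2]]|] := boolP [exists j : 'I_N,
      ((`|half w| < 5 * S) && (Num.truncn ((half w + 5 * S) / wd) == j))%R &&
      ((`|half (opp w)| < 5 * S) && (Num.truncn ((half (opp w) + 5 * S) / wd) == j))%R].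
    rewrite (_ : `|X w| < wd); last first.
      move/andP: j1 => [/shift0/truncn_itv h1 /eqP e1].
      move/andP: j2 => [/shift0/truncn_itv h2 /eqP e2].
      rewrite e1 in h1; rewrite e2 in h2.
      move: h1 h2; rewrite !ler_pdivlMr// !ltr_pdivrMr// -natr1 split_half ltr_norml.
      by move=> h1 h2; apply/andP; split; lra.
    apply: (le_trans _ (@sum_pred_le1 R _ (fun j : 'I_N =>
      (`|half w| < 5 * S) && (Num.truncn ((half w + 5 * S) / wd) == j))%R _)).
      apply: ler_sum => i _; rewrite /bin -natrM ler_nat.
      by case: (_ && _); case: (_ && _).
    by move=> i i' /andP[_ /eqP e] /andP[_ /eqP e']; apply/val_inj; rewrite /= -e -e'.
  move=> /existsPn no; rewrite big1 ?ler0n// => j _; have := no j.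
  by rewrite negb_and /bin => /orP[] /negbTE ->; rewrite ?mul0r ?mulr0.
have indep j : avg (fun w => bin j w * bin j (opp w)) = p j ^+ 2.
  rewrite (@avg_indep _ _ a) ?expr2.
  - by congr (_ * _); rewrite /p [RHS](reindex_avg _ oppK).
  - move=> w w' ww'; rewrite /bin (_ : half w = half w')//.
    by apply: eq_bigr => i ai; rewrite ww'.
  - move=> w w' ww'; rewrite /bin (_ : half (opp w) = half (opp w'))//.
    apply: eq_bigr => i ai; rewrite !ffunE.
    have [->|ci] := eqVneq (c i) 0; first by rewrite !mul0r.
    by rewrite ww'// asP// ai.
have psum : 2^-1 <= \sum_j p j.
  rewrite -avg_sum.
  have -> : 2^-1 = avg (fun _ : Om => 1) - 2^-1 :> R by rewrite (avg_cst w0); lra.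
  have tail : avg (fun w : Om => (5 * S <= `|half w|)%R%:R) <= 2^-1 :> R.
    have h := @rademacher_tail R J (fun j => if a j then c j else 0) S 5 S0.
    apply: (@le_trans _ _ (expR (3 / 2 - 5 / 2))).
      apply: (le_trans _ (h _)).
        apply: ler_avg => w.
        rewrite (_ : half w = \sum_j (if a j then c j else 0) * sgnb (w j))//.
        rewrite /half big_mkcond; apply: eq_bigr => j _.
        by case: ifP => //; rewrite mul0r.
      apply: le_trans cS; apply: ler_sum => j _; case: ifP => // _.
      by rewrite expr0n sqr_ge0.
    rewrite -[leLHS]invrK -expRN lef_pV2 ?posrE ?expR_gt0//.
    by apply: le_trans (expR_ge1Dx _); lra.
  apply: (@le_trans _ _ (avg (fun _ : Om => 1) -
    avg (fun w : Om => (5 * S <= `|half w|)%R%:R))).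
    by rewrite lerD2l lerN2.
  rewrite -avgB; apply: ler_avg => w.
  have [h|h] := leP (5 * S) `|half w|; first by rewrite subrr sumr_ge0.
  rewrite subr0.
  have jN : (Num.truncn ((half w + 5 * S) / wd) < N)%N.
    rewrite ltnS; apply: le_truncn; rewrite ler_pM2r ?invr_gt0//.
    by move: h; rewrite ltr_norml; lra.
  rewrite (bigD1 (Ordinal jN))//= /bin h eqxx/= lerDl sumr_ge0//.
have NR : N%:R <= 10 * S / wd + 1.
  by rewrite /N -[leLHS]natr1 lerD2r; have /andP[] := truncn_itv Swd0.
have N0 : 0 < N%:R :> R by rewrite ltr0n.
apply: (@le_trans _ _ (\sum_j p j ^+ 2)); last first.
  by rewrite -(eq_bigr _ (fun j _ => indep j)) -avg_sum; apply: ler_avg.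
(* Cauchy-Schwarz against the constant [1 / (2 N)]. *)
have cs2 : \sum_j p j * N%:R^-1 - \sum_(j < N) (2 * N%:R)^-1 ^+ 2 <= \sum_j p j ^+ 2.
  rewrite -sumrB; apply: ler_sum => j _.
  have -> : N%:R^-1 = 2 * (2 * N%:R)^-1 :> R by field; rewrite gt_eqF.
  have := sqr_ge0 (p j - (2 * N%:R)^-1); set u := (2 * N%:R)^-1; lra.
apply: le_trans cs2; rewrite -mulr_suml sumr_const card_ord -[_ ^+ 2 *+ _]mulr_natl.
apply: (@le_trans _ _ (2^-1 / N%:R - N%:R * (2 * N%:R)^-1 ^+ 2)); last first.
  by rewrite lerD2r ler_pM2r ?invr_gt0.
have -> : 2^-1 / N%:R - N%:R * (2 * N%:R)^-1 ^+ 2 = (4 * N%:R)^-1 :> R.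
  by field; rewrite gt_eqF.
by rewrite lef_pV2 ?posrE ?mulr_gt0//; lra.
Qed.

Lemma rademacher_subexp (wd t : R) : 0 < wd -> 0 < t ->
  \sum_j c j ^+ 2 <= (wd / (80 * t)) ^+ 2 ->
  avg (fun w : Om => (wd <= `|X w|)%R%:R) <= expR (- t).
Proof.
move=> wd0 t0; set S := wd / (80 * t) => cS.
have S0 : 0 < S by rewrite divr_gt0 ?mulr_gt0.
have St : wd = 80 * t * S by rewrite /S mulrC divfK// gt_eqF ?mulr_gt0.
have [t8|t8] := leP 8^-1 t.
  rewrite St; apply: (le_trans (rademacher_tail (80 * t) S0 cS)).
  by rewrite ler_expR; lra.
have := avg_small_ball S0 wd0 cS.
have -> : 10 * S / wd = (8 * t)^-1.
  by rewrite St; field; rewrite !gt_eqF.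
have -> : (fun w : Om => (wd <= `|X w|)%R%:R) =
    (fun w : Om => 1 - (`|X w| < wd)%R%:R) :> (Om -> R).
  by apply/funext => w; rewrite ltNge; case: (wd <= `|X w|); rewrite /= ?subrr ?subr0.
rewrite avgB (avg_cst [ffun=> true]) => h.
have e1 : 1 + - t <= expR (- t) by exact: expR_ge1Dx.
suff : t <= (4 * ((8 * t)^-1 + 1))^-1 by lra.
have -> : (4 * ((8 * t)^-1 + 1))^-1 = 2 * t / (1 + 8 * t).
  by field; rewrite !gt_eqF//; lra.
rewrite ler_pdivlMr; last by lra.
nra.
Qed.

End small_ball.

(** * Hellinger affinity of runs *)

Section run_value_linear.
Context {R : realType} {d : nat} {I : finType}.
Variable Phi : I -> 'rV[R]_d -> 'rV[R]_d.
Variables (A : algorithm R d).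
Implicit Types (G H : 'rV[R]_d -> R).

Lemma eq_run_value G H n t (s : seed A) (h : t.-tuple 'rV[R]_d) :
  G =1 H -> run_value Phi G n s h = run_value Phi H n s h.
Proof. by move=> GH; congr (run_value Phi _ n s h); apply/funext. Qed.

Lemma run_valueD G H n t (s : seed A) (h : t.-tuple 'rV[R]_d) :
  run_value Phi (fun x => G x + H x) n s h =
  run_value Phi G n s h + run_value Phi H n s h.
Proof.
elim: n t h => [|n IH] t h /=; case: ifP => // _; first by rewrite addr0.
by rewrite -avgD; apply: eq_avg => i; rewrite IH.
Qed.

Lemma run_valueZ c G n t (s : seed A) (h : t.-tuple 'rV[R]_d) :
  run_value Phi (fun x => c * G x) n s h = c * run_value Phi G n s h.
Proof.
elim: n t h => [|n IH] t h /=; case: ifP => // _; first by rewrite mulr0.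
by rewrite -avgZ; apply: eq_avg => i; rewrite IH.
Qed.

Lemma run_value_sum (J : finType) (G : J -> 'rV[R]_d -> R) n t (s : seed A)
    (h : t.-tuple 'rV[R]_d) :
  run_value Phi (fun x => \sum_j G j x) n s h =
  \sum_j run_value Phi (G j) n s h.
Proof.
elim: n t h => [|n IH] t h /=; case: ifP => // _; first by rewrite big1.
by rewrite -avg_sum; apply: eq_avg => i; rewrite IH.
Qed.

Lemma ler_run_value G H n t (s : seed A) (h : t.-tuple 'rV[R]_d) :
  (forall x, G x <= H x) -> run_value Phi G n s h <= run_value Phi H n s h.
Proof.
move=> GH; elim: n t h => [|n IH] t h /=; case: ifP => // _.
by apply: ler_avg => i; exact: IH.
Qed.

End run_value_linear.

Section hellinger.
Context {R : realType} {d : nat} {I K : finType} (i0 : I) (k0 : K).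
Variables (Phi Phi' : I -> 'rV[R]_d -> 'rV[R]_d).
Variables (Y : K -> 'rV[R]_d -> 'rV[R]_d) (X : K -> R) (kappa : R).
Hypothesis X1 : forall k, `|X k| <= 1.
Hypothesis X2 : avg (fun k => X k ^+ 2) <= kappa.
Hypothesis kappa1 : kappa <= 1.
(* The two answer laws have densities [1 + X] and [1 - X] with respect to the
   law of [Y]. *)
Hypothesis PhiY : forall x (F : 'rV[R]_d -> R),
  avg (fun i => F (Phi i x)) = avg (fun k => (1 + X k) * F (Y k x)).
Hypothesis PhiY' : forall x (F : 'rV[R]_d -> R),
  avg (fun i => F (Phi' i x)) = avg (fun k => (1 - X k) * F (Y k x)).
Variables (A : algorithm R d) (G : 'rV[R]_d -> R).
Hypothesis G01 : forall x, 0 <= G x <= 1.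

Let al n t s h := @run_value R d I Phi A G n t s h.
Let be n t s h := @run_value R d I Phi' A G n t s h.

Let avg1X : avg (fun k => 1 + X k) = 1.
Proof.
have := PhiY 0 (fun=> 1); rewrite (avg_cst i0) => e; rewrite [RHS]e.
by apply: eq_avg => k; rewrite mulr1.
Qed.

Let avgX : avg X = 0.
Proof. by have := avg1X; rewrite avgD (avg_cst k0); lra. Qed.

(* The Hellinger affinity [sqrt (a b) + sqrt ((1 - a) (1 - b))] of two
   Bernoulli laws is the infimum over [z, w > 0] of half the left-hand side;
   in this form it tensorizes along a run without any square root of [a, b]. *)
Lemma run_value_affinity n t (s : seed A) (h : t.-tuple 'rV[R]_d) (z w : R) :
  0 < z -> 0 < w ->
  2 * (1 - kappa) ^+ n <=
  z * al n s h + z^-1 * be n s h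
    + w * (1 - al n s h) + w^-1 * (1 - be n s h).
Proof.
have amgm (y a : R) : 0 < y -> 0 <= a -> 2 * a <= y * a + y^-1 * a.
  move=> y0 a0; rewrite -mulrDl ler_wpM2r//.
  rewrite -subr_ge0 (_ : _ - _ = y^-1 * (y - 1) ^+ 2).
    by rewrite mulr_ge0 ?sqr_ge0// invr_ge0 ltW.
  by field; rewrite gt_eqF.
have base m (y v a : R) : 0 < y -> 0 < v -> 0 <= a <= 1 ->
    2 * (1 - kappa) ^+ m <= y * a + y^-1 * a + v * (1 - a) + v^-1 * (1 - a).
  move=> y0 v0 /andP[a0 a1].
  have h1 := amgm y a y0 a0; have h2 : 2 * (1 - a) <= v * (1 - a) + v^-1 * (1 - a).
    by apply: amgm => //; lra.
  have h3 : (1 - kappa) ^+ m <= 1.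
    rewrite exprn_ile1 ?subr_ge0// gerBl.
    by apply: le_trans X2; apply: avg_ge0 => k; exact: sqr_ge0.
  lra.
elim: n t h z w => [|n IH] t h z w z0 w0; rewrite /al /be /=.
  case: ifP => _; first exact: (base 0%N).
  by apply: (base 0%N) => //; rewrite lexx ler01.
case: ifP => _; first exact: (base n.+1).
set x := query (s, h).
pose hk k := [tuple of rcons h (Y k x)].
pose a k := al n s (hk k); pose b k := be n s (hk k).
rewrite (PhiY x (fun y => run_value Phi G n s [tuple of rcons h y])).
rewrite (PhiY' x (fun y => run_value Phi' G n s [tuple of rcons h y])).
rewrite -[avg (fun k => _ * run_value Phi _ _ _ _)]/(avg (fun k => (1 + X k) * a k)).
rewrite -[avg (fun k => _ * run_value Phi' _ _ _ _)]/(avg (fun k => (1 - X k) * b k)).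
have -> : 1 - avg (fun k => (1 + X k) * a k) = avg (fun k => (1 + X k) * (1 - a k)).
  transitivity (avg (fun k => 1 + X k) - avg (fun k => (1 + X k) * a k)).
    by rewrite avg1X.
  by rewrite -avgB; apply: eq_avg => k; ring.
have -> : 1 - avg (fun k => (1 - X k) * b k) = avg (fun k => (1 - X k) * (1 - b k)).
  transitivity (avg (fun k => 1 - X k) - avg (fun k => (1 - X k) * b k)).
    by rewrite avgB avgX (avg_cst k0) subr0.
  by rewrite -avgB; apply: eq_avg => k; ring.
rewrite -!avgZ -!avgD.
apply: (@le_trans _ _ (avg (fun k => (1 - X k ^+ 2) * (2 * (1 - kappa) ^+ n)))).
  under eq_avg do rewrite mulrC.
  rewrite avgZ avgB (avg_cst k0) exprS mulrA [2 * _]mulrC -mulrA mulrC.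
  by rewrite ler_wpM2l ?mulr_ge0 ?exprn_ge0 ?subr_ge0// lerD2l lerN2.
apply: ler_avg => k.
have rn0 : 0 <= 2 * (1 - kappa) ^+ n by rewrite mulr_ge0 ?exprn_ge0 ?subr_ge0.
have run01 (Psi : I -> 'rV[R]_d -> 'rV[R]_d) :
    0 <= run_value Psi G n s (hk k) <= 1.
  rewrite (run_value_ge0 _ _ _ _ (fun y => proj1 (andP (G01 y)))).
  by apply: (run_value_le1 i0) => y; have /andP[] := G01 y.
have /andP[a0 a1] : 0 <= a k <= 1 by exact: run01.
have /andP[b0 b1] : 0 <= b k <= 1 by exact: run01.
move: (X1 k); rewrite ler_norml => /andP[xl xr].
have [x1|x1] := eqVneq (X k ^+ 2) 1.
  rewrite x1 subrr mul0r !addr_ge0// !mulr_ge0 ?invr_ge0 ?(ltW z0) ?(ltW w0)//; lra.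
have x2 : 0 < 1 - X k ^+ 2.
  rewrite subr_gt0 lt_neqAle x1/= -real_normK ?num_real// exprn_ile1//.
have xm : 0 < 1 - X k.
  rewrite lt_neqAle subr_ge0 xr andbT eq_sym subr_eq0.
  by apply: contraNneq x1 => <-; rewrite expr1n.
pose S : R := Num.sqrt (1 - X k ^+ 2); pose q : R := S / (1 - X k).
have S0 : 0 < S by rewrite sqrtr_gt0.
have S2 : S ^+ 2 = 1 - X k ^+ 2 by rewrite sqr_sqrtr// ltW.
have q0 : 0 < q by rewrite divr_gt0.
have Sq : 1 + X k = S * q.
  apply: (mulIf (lt0r_neq0 xm)); rewrite /q mulrA divfK ?gt_eqF// -expr2 S2; ring.
have Siq : 1 - X k = S * q^-1.
  by rewrite /q invf_div mulrCA divff ?mulr1// gt_eqF.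
clearbody q.
have S1 : S <= 1.
  by rewrite -sqrtr1 ler_wsqrtr// gerBl sqr_ge0.
have := IH _ (hk k) _ _ (mulr_gt0 z0 q0) (mulr_gt0 w0 q0).
rewrite -/(a k) -/(b k) !invfM => ih.
apply: (@le_trans _ _ (S * (2 * (1 - kappa) ^+ n))).
  by rewrite ler_wpM2r// -S2 expr2 ler_piMl// ltW.
apply: (le_trans (ler_wpM2l (ltW S0) ih)).
rewrite /= Sq Siq le_eqVlt; apply/orP; left; apply/eqP; ring.
Qed.

Lemma run_value_diff T (s : seed A) :
  `|al T s [tuple] - be T s [tuple]| ^+ 2 <= 4 * (T%:R * kappa).
Proof.
set a := al T s [tuple]; set b := be T s [tuple].
have kap0 : 0 <= kappa by apply: le_trans X2; apply: avg_ge0 => k; exact: sqr_ge0.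
have /andP[a0 a1] : 0 <= a <= 1.
  rewrite (run_value_ge0 _ _ _ _ (fun y => proj1 (andP (G01 y)))).
  by apply: (run_value_le1 i0) => y; have /andP[] := G01 y.
have /andP[b0 b1] : 0 <= b <= 1.
  rewrite (run_value_ge0 _ _ _ _ (fun y => proj1 (andP (G01 y)))).
  by apply: (run_value_le1 i0) => y; have /andP[] := G01 y.
have bern : 1 - T%:R * kappa <= (1 - kappa) ^+ T.
  elim: T {a b a0 a1 b0 b1} => [|n IH]; first by rewrite mul0r subr0.
  have k1 : 0 <= 1 - kappa by rewrite subr_ge0.
  rewrite exprS; apply: le_trans (ler_wpM2l k1 IH).
  have : 0 <= n%:R * kappa * kappa by rewrite !mulr_ge0.
  rewrite -natr1; lra.
set D := a - b; pose t := D / 2.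
have Db : -1 <= D <= 1 by rewrite /D; apply/andP; split; lra.
have z0 : 0 < 1 - t by rewrite /t; lra.
have w0 : 0 < 1 + t by rewrite /t; lra.
have := @run_value_affinity T 0 s [tuple] _ _ z0 w0; rewrite -/a -/b => aff.
have ez : (1 - t)^-1 <= 1 + t + 2 * t ^+ 2.
  rewrite -[leLHS]mul1r ler_pdivrMr//.
  have := sqr_ge0 t; have : t <= 2^-1 by rewrite /t; lra.
  set u := t ^+ 2.
  have -> : (1 + t + 2 * u) * (1 - t) = 1 + u * (1 - 2 * t) by rewrite /u; ring.
  move=> t2 u0; rewrite lerDl mulr_ge0//; lra.
have ew : (1 + t)^-1 <= 1 - t + 2 * t ^+ 2.
  rewrite -[leLHS]mul1r ler_pdivrMr//.
  have := sqr_ge0 t; have : - 2^-1 <= t by rewrite /t; lra.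
  set u := t ^+ 2.
  have -> : (1 - t + 2 * u) * (1 + t) = 1 + u * (1 + 2 * t) by rewrite /u; ring.
  move=> t2 u0; rewrite lerDl mulr_ge0//; lra.
have h1 := ler_wpM2r b0 ez.
have b1' : 0 <= 1 - b by lra.
have h2 := ler_wpM2r b1' ew.
rewrite real_normK ?num_real//.
have tD : D = 2 * t by rewrite /t; lra.
have aE : a = b + 2 * t by rewrite -tD /D; ring.
rewrite -/D tD; rewrite aE in aff.
move: h1 h2 aff; set iz := (1 - t)^-1; set iw := (1 + t)^-1 => h1 h2 aff.
nra.
Qed.

End hellinger.

(** * The noise term *)

Section noisy_cube.
Context {R : realType} {d : nat} (m : nat) (gamma r mu : R).
Hypotheses (gamma0 : 0 < gamma) (mu0 : 0 < mu).

(* The [inl] bit of a coordinate is overwritten by the hidden sign, so that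
   sign and noise together form [2 m + 1] exchangeable bits. *)
Local Notation bits := (unit + bool * 'I_m)%type.
Local Notation J := ('I_d * bits)%type.
Local Notation Om := {ffun J -> bool}.
Local Notation cube := {ffun 'I_d -> bool}.
Local Notation l0 := (inl tt : bits).
Implicit Types (v : cube) (w : Om) (x : 'rV[R]_d) (i k : 'I_d).

Definition cube_center v : 'rV[R]_d := \row_i (r * sgnb (v i)).

Definition cube_instance v x : R := gamma * sum_sabs mu (cube_center v) x.

Definition cube_gradient v x : 'rV[R]_d := gamma *: dsum_sabs mu (cube_center v) x.

Definition grad_mean x i : R :=
  gamma * (dsabs mu (x ord0 i - r) + dsabs mu (x ord0 i + r)) / 2.

Definition grad_gap x i : R :=
  gamma * (dsabs mu (x ord0 i - r) - dsabs mu (x ord0 i + r)) / 2.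

Lemma cube_gradientE v x i :
  cube_gradient v x ord0 i = grad_mean x i + grad_gap x i * sgnb (v i).
Proof.
rewrite !mxE /grad_mean /grad_gap /sgnb; case: (v i); first by rewrite mulr1; lra.
by rewrite mulrN1 opprK; lra.
Qed.

Lemma grad_gap_bound x i : `|grad_gap x i| <= gamma.
Proof.
have /andP[a1 a2] := dsabs_bound mu (x ord0 i - r).
have /andP[b1 b2] := dsabs_bound mu (x ord0 i + r).
have g0 := gamma0.
rewrite /grad_gap -mulrA normrM gtr0_norm// ler_piMr ?(ltW g0)// ler_norml.
by apply/andP; split; lra.
Qed.

Definition noise w i : R := \sum_(p : bool * 'I_m) sgnb (w (i, inr p)).

Definition noisy_gradient v w x : 'rV[R]_d :=
  \row_i (grad_mean x i + grad_gap x i * (sgnb (v i) + noise w i)).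

Lemma measurable_noisy_gradient v w : measurable_fun setT (noisy_gradient v w).
Proof.
apply/measurable_rVP => i.
rewrite (_ : (fun x => _) = (fun x =>
  grad_mean x i + grad_gap x i * (sgnb (v i) + noise w i))); last first.
  by apply/funext => x; rewrite mxE.
have m1 : measurable_fun setT (fun x : 'rV[R]_d => dsabs mu (x ord0 i - r)).
  apply: (measurableT_comp (measurable_dsabs mu)).
  by apply: measurable_funB => //; exact: measurable_coord.
have m2 : measurable_fun setT (fun x : 'rV[R]_d => dsabs mu (x ord0 i + r)).
  apply: (measurableT_comp (measurable_dsabs mu)).
  by apply: measurable_funD => //; exact: measurable_coord.
apply: measurable_funD.
  by do 2 apply: measurable_funM => //; exact: measurable_funD.
apply: measurable_funM => //.
by do 2 apply: measurable_funM => //; exact: measurable_funB.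
Qed.

Definition semi_noisy_gradient i v w x : 'rV[R]_d :=
  \row_k (grad_mean x k +
    grad_gap x k * ((if k == i then sgnb (w (k, l0)) else sgnb (v k)) + noise w k)).

Lemma noisy_gradient_put i v w x :
  noisy_gradient v w x = semi_noisy_gradient i v (put (i, l0) (v i) w) x.
Proof.
apply/rowP => k; rewrite !mxE; congr (_ + _ * (_ + _)).
  by case: eqP => // ->; rewrite ffunE eqxx.
by apply: eq_bigr => p _; rewrite ffunE; case: eqP => // -[].
Qed.

Lemma semi_noisy_gradient_flip i v :
  semi_noisy_gradient i (flip i v) = semi_noisy_gradient i v.
Proof.
apply/funext => w; apply/funext => x; apply/rowP => k; rewrite !mxE.
by case: eqP => // /eqP/negbTE ki; rewrite ffunE ki.
Qed.

Definition swap_bits i (l : bits) (j : J) : J :=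
  if j.1 == i then (j.1, tperm l0 l j.2) else j.

Lemma swap_bitsK i l : involutive (swap_bits i l).
Proof.
move=> [k p]; rewrite /swap_bits/=; have [->|ki] := eqVneq k i.
  by rewrite eqxx tpermK.
by rewrite (negbTE ki).
Qed.

Lemma semi_noisy_gradient_sum i v w x : semi_noisy_gradient i v w x =
  \row_k (grad_mean x k + grad_gap x k *
    (if k == i then \sum_(l : bits) sgnb (w (k, l)) else sgnb (v k) + noise w k)).
Proof.
apply/rowP => k; rewrite !mxE; congr (_ + _ * _); case: eqP => // _.
by rewrite big_sumType/= /noise; congr (_ + _); rewrite (bigD1 tt)//= big1 ?addr0// => -[].
Qed.

Lemma semi_noisy_gradient_swap i v l w x :
  semi_noisy_gradient i v (permute (swap_bits i l) w) x = semi_noisy_gradient i v w x.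
Proof.
rewrite !semi_noisy_gradient_sum; apply/rowP => k; rewrite !mxE; congr (_ + _ * _).
case: eqP => [->|/eqP/negbTE ki].
  rewrite [RHS](reindex_inj (@perm_inj _ (tperm l0 l)))/=.
  by apply: eq_bigr => p _; rewrite ffunE /swap_bits eqxx.
congr (_ + _); apply: eq_bigr => p _.
by rewrite ffunE /swap_bits/= ki.
Qed.

Definition mean_bit i w : R := (2 * m).+1%:R^-1 * \sum_(l : bits) sgnb (w (i, l)).

Lemma card_bits : #|{: bits}| = (2 * m).+1.
Proof. by rewrite card_sum card_unit card_prod card_bool card_ord. Qed.

Lemma noisy_gradient_density i v x (F : 'rV[R]_d -> R) :
  avg (fun w => F (noisy_gradient v w x)) =
  avg (fun w => (1 + sgnb (v i) * mean_bit i w) * F (semi_noisy_gradient i v w x)).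
Proof.
under eq_avg do rewrite (noisy_gradient_put i).
rewrite (avg_put (i, l0) (v i) (fun w => F (semi_noisy_gradient i v w x))).
pose H l := avg (fun w => sgnb (w (i, l)) * F (semi_noisy_gradient i v w x)).
have HE l : H l0 = H l.
  rewrite /H (reindex_avg _ (permuteK (@swap_bitsK i l))); apply: eq_avg => w /=.
  by rewrite semi_noisy_gradient_swap ffunE /swap_bits/= eqxx tpermL.
transitivity (avg (fun w => F (semi_noisy_gradient i v w x)) + sgnb (v i) * H l0).
  by rewrite /H -avgZ -avgD; apply: eq_avg => w; ring.
have -> : H l0 = avg (fun w => mean_bit i w * F (semi_noisy_gradient i v w x)).
  have -> : H l0 = (2 * m).+1%:R^-1 * \sum_(l : bits) H l.
    rewrite -(eq_bigr _ (fun l _ => HE l)) sumr_const card_bits -[H l0 *+ _]mulr_natl.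
    by rewrite mulKf// pnatr_eq0.
  rewrite -avg_sum -avgZ; apply: eq_avg => w.
  by rewrite /mean_bit -mulr_suml mulrA.
by rewrite -avgZ -avgD; apply: eq_avg => w; ring.
Qed.

Lemma mean_bit_bound i w : `|mean_bit i w| <= 1.
Proof.
rewrite /mean_bit normrM ger0_norm ?invr_ge0// mulrC ler_pdivrMr ?ltr0n// mul1r.
apply: (le_trans (ler_norm_sum _ _ _)).
under eq_bigr do rewrite normr_sgnb.
by rewrite sumr_const card_bits.
Qed.

Lemma avg_mean_bit_sqr i : avg (fun w => mean_bit i w ^+ 2) = (2 * m).+1%:R^-1.
Proof.
have n0 : (2 * m).+1%:R != 0 :> R by rewrite pnatr_eq0.
pose w0 : Om := [ffun=> true].
have -> : avg (fun w => mean_bit i w ^+ 2) = (2 * m).+1%:R^-1 ^+ 2 *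
    avg (fun w => \sum_(l : bits) \sum_(l' : bits) sgnb (w (i, l)) * sgnb (w (i, l')) : R).
  rewrite -avgZ; apply: eq_avg => w; rewrite /mean_bit exprMn; congr (_ * _).
  by rewrite expr2 mulr_suml; apply: eq_bigr => l _; rewrite mulr_sumr.
rewrite avg_sum (eq_bigr (fun=> 1)) => [|l _].
  by rewrite sumr_const card_bits expr2 -mulrA mulVf// mulr1.
rewrite avg_sum (bigD1 l)//= big1 ?addr0 => [|l' ll'].
  by rewrite (eq_avg (G := fun=> 1)) ?(avg_cst w0)// => w; rewrite -expr2 sgnb_sqr.
by apply: avg_sgnb_neq; rewrite xpair_eqE eqxx/= eq_sym.
Qed.

Lemma run_value_flip (A : algorithm R d) (G : 'rV[R]_d -> R) T (s : seed A) i v :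
  (forall x, 0 <= G x <= 1) ->
  `|run_value (noisy_gradient v) G T s [tuple] -
    run_value (noisy_gradient (flip i v)) G T s [tuple]| ^+ 2
  <= 4 * (T%:R / (2 * m).+1%:R).
Proof.
move=> G01; pose w0 : Om := [ffun=> true].
pose X w := sgnb (v i) * mean_bit i w.
have kap1 : (2 * m).+1%:R^-1 <= 1 :> R by rewrite invf_le1 ?ltr0n// ler1n.
apply: (@run_value_diff R d Om Om w0 w0 (noisy_gradient v)
  (noisy_gradient (flip i v)) (semi_noisy_gradient i v) X _ _ _ kap1) => //.
- by move=> w; rewrite /X normrM normr_sgnb mul1r mean_bit_bound.
- rewrite -(avg_mean_bit_sqr i); apply: ler_avg => w.
  by rewrite /X exprMn sgnb_sqr mul1r.
- by move=> x F; rewrite (noisy_gradient_density i).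
- move=> x F; rewrite (noisy_gradient_density i) semi_noisy_gradient_flip.
  by apply: eq_avg => w; rewrite ffunE eqxx sgnbN mulNr.
Qed.

Lemma cube_smooth v : smooth_convex (cube_instance v) (cube_gradient v).
Proof. by apply: smooth_convexZ (ltW gamma0) _; exact: smooth_convex_sum_sabs. Qed.

Lemma cube_min v y : cube_instance v (cube_center v) <= cube_instance v y.
Proof. by rewrite ler_pM2l// sum_sabs_min. Qed.

Lemma cube_sco (L Rad : R) v : gamma * Num.sqrt d%:R <= L ->
  Num.sqrt d%:R * `|r| <= Rad -> sco_instance L Rad (cube_instance v).
Proof.
move=> gL rRad; apply: (sco_instance_smooth (cube_smooth v) (xstar := cube_center v)).
- move=> x y; rewrite -mulrBr normrM (gtr0_norm gamma0).
  apply: (@le_trans _ _ (gamma * (Num.sqrt d%:R * enorm (x - y)))).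
    by rewrite ler_pM2l// sum_sabs_lip.
  by rewrite mulrA ler_wpM2r ?enorm_ge0.
- exact: cube_min.
- apply: le_trans rRad; rewrite /enorm dotpp_sum.
  under eq_bigr do rewrite mxE exprMn sgnb_sqr mulr1.
  by rewrite sumr_const card_ord -[_ ^+ 2 *+ _]mulr_natl sqrtrM// sqrtr_sqr.
Qed.

Lemma avg_noise i : avg (fun w => noise w i) = 0.
Proof.
rewrite avg_sum big1// => p _.
have e := reindex_avg (fun w : Om => sgnb (w (i, inr p)) : R) (flipK (i, inr p)).
have : avg (fun w : Om => sgnb (w (i, inr p)) : R) =
    - avg (fun w : Om => sgnb (w (i, inr p))).
  rewrite {1}e -mulN1r -avgZ; apply: eq_avg => w /=.
  by rewrite !ffunE eqxx sgnbN mulN1r.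
lra.
Qed.

Lemma noisy_gradientB v w x :
  noisy_gradient v w x - cube_gradient v x = \row_i (grad_gap x i * noise w i).
Proof.
apply/rowP => i; have := cube_gradientE v x i.
by rewrite !mxE => ->; ring.
Qed.

Lemma cube_ISGO (sigma delta : R) v w0 : (0 < d)%N -> 0 < sigma ->
  0 < delta -> delta < 1 ->
  gamma ^+ 2 * (2 * m)%:R <= (sigma / Num.sqrt d%:R / (80 * ln (1 / delta))) ^+ 2 ->
  is_ISGO sigma delta (cube_instance v)
    (unif_oracle w0 (measurable_noisy_gradient v)).
Proof.
move=> d0 s0 dl0 dl1 hm; have gE := smooth_convex_gradient (cube_smooth v).
have wd0 : 0 < sigma / Num.sqrt d%:R by rewrite divr_gt0// sqrtr_gt0 ltr0n.
have t0 : 0 < ln (1 / delta) by rewrite ln_gt0// ltr_pdivlMr// mul1r.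
apply: unif_oracle_ISGO => [x i|x u u1]; rewrite gE.
  rewrite cube_gradientE.
  have -> : (fun w => noisy_gradient v w x ord0 i) = (fun w =>
      grad_mean x i + grad_gap x i * sgnb (v i) + grad_gap x i * noise w i).
    by apply/funext => w; rewrite mxE; ring.
  by rewrite avgD avgZ avg_noise mulr0 addr0 (avg_cst w0).
pose c (j : J) : R := if j.2 is inr _ then grad_gap x j.1 * u ord0 j.1 else 0.
have dotE w : dotp (noisy_gradient v w x - cube_gradient v x) u = \sum_j c j * sgnb (w j).
  rewrite noisy_gradientB sum_pair.
  apply: eq_bigr => i _; rewrite mxE big_sumType/= big1 ?add0r; last first.
    by move=> ? _; rewrite mul0r.
  by rewrite /c/= -mulr_sumr mulrAC.
have csum : \sum_j c j ^+ 2 <= (sigma / Num.sqrt d%:R / (80 * ln (1 / delta))) ^+ 2.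
  apply: le_trans hm.
  rewrite sum_pair.
  apply: (@le_trans _ _ (\sum_i (gamma ^+ 2 * (2 * m)%:R) * (u ord0 i ^+ 2))).
    apply: ler_sum => i _; rewrite big_sumType/= big1 ?add0r; last first.
      by move=> ? _; rewrite expr0n.
    rewrite /c/= sumr_const card_prod card_bool card_ord.
    rewrite -[_ ^+ 2 *+ _]mulr_natl [leRHS]mulrAC exprMn.
    rewrite [leLHS](_ : _ = grad_gap x i ^+ 2 * u ord0 i ^+ 2 * (2 * m)%:R); last by ring.
    rewrite ler_wpM2r// ler_wpM2r ?sqr_ge0// -real_normK ?num_real//.
    rewrite ler_pXn2r ?nnegrE ?(ltW gamma0)//.
    exact: grad_gap_bound.
  by rewrite -mulr_sumr -dotpp_sum -enorm_sqr u1 expr1n mulr1.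
rewrite (eq_avg (G := fun w =>
  (sigma / Num.sqrt d%:R <= `|\sum_j c j * sgnb (w j)|)%R%:R)); last first.
  by move=> w; rewrite dotE.
pose sw (j : J) : J := (j.1, if j.2 is inr p then inr (~~ p.1, p.2) else j.2).
pose a (j : J) := if j.2 is inr p then p.1 else false.
have sK : involutive sw by move=> [i [[]|[b p]]]; rewrite /sw/= ?negbK.
have cs j : c (sw j) = c j by case: j => i [[]|p].
have asP j : c j != 0 -> a (sw j) = ~~ a j by case: j => i [[]|p]; rewrite /c /a//= eqxx.
apply: (le_trans (rademacher_subexp sK cs asP wd0 t0 csum)).
by rewrite -lnV ?posrE ?divr_gt0// div1r invrK lnK ?posrE.
Qed.

End noisy_cube.

Section correlation.
Context {R : realType} {d : nat} (X : Type).
Local Notation cube := {ffun 'I_d -> bool}.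
(* [E v G] is the mean payoff [G] of a run against the instance [v]. *)
Variables (E : cube -> (X -> R) -> R) (xi : 'I_d -> X -> R) (b Del : R).
Hypothesis d0 : (0 < d)%N.
Hypothesis b0 : 0 < b.
Hypothesis ED : forall v G H, E v (fun x => G x + H x) = E v G + E v H.
Hypothesis EZ : forall v c G, E v (fun x => c * G x) = c * E v G.
Hypothesis Esum : forall v (J : finType) (G : J -> X -> R),
  E v (fun x => \sum_j G j x) = \sum_j E v (G j).
Hypothesis Emono : forall v G H, (forall x, G x <= H x) -> E v G <= E v H.
Hypothesis E1 : forall v, E v (fun=> 1) <= 1.
Hypothesis Eflip : forall v i G, (forall x, 0 <= G x <= 1) ->
  `|E v G - E (flip i v) G| <= Del.
Hypothesis xi1 : forall i x, `|xi i x| <= 1.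
Variable win : cube -> X -> bool.
Hypothesis win_corr : forall v x, win v x ->
  d%:R * b <= \sum_i sgnb (v i) * xi i x.

Let dR0 : 0 < d%:R :> R. Proof. by rewrite ltr0n. Qed.

Let Del0 : 0 <= Del.
Proof.
apply: le_trans (Eflip [ffun=> true] (Ordinal d0) (G := fun=> 1) _) => // x.
by rewrite ler01 lexx.
Qed.

Let Eflip_signed v i G : (forall x, `|G x| <= 1) ->
  `|E v G - E (flip i v) G| <= 3 * Del.
Proof.
move=> G1; pose H x := 2^-1 * (1 + G x).
have H01 x : 0 <= H x <= 1.
  by have := G1 x; rewrite ler_norml /H => h; apply/andP; split; lra.
have EG u : E u G = 2 * E u H - E u (fun=> 1).
  have -> : E u H = 2^-1 * (E u (fun=> 1) + E u G) by rewrite EZ ED.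
  lra.
have h1 := Eflip v i H01.
have h2 : `|E v (fun=> 1) - E (flip i v) (fun=> 1)| <= Del.
  by apply: Eflip => x; rewrite ler01 lexx.
rewrite !EG; move: h1 h2; rewrite !ler_norml => h1 h2; apply/andP; split; lra.
Qed.

Lemma avg_cross i j : i != j ->
  avg (fun v : cube => E v (fun x => (sgnb (v i) * xi i x) * (sgnb (v j) * xi j x)))
    <= 3 / 2 * Del.
Proof.
move=> ij; pose P v := E v (fun x => xi i x * xi j x).
have PE v : E v (fun x => (sgnb (v i) * xi i x) * (sgnb (v j) * xi j x)) =
    sgnb (v i) * sgnb (v j) * P v.
  by rewrite -EZ; congr (E v); apply/funext => x; ring.
under eq_avg do rewrite PE.
have e := reindex_avg (fun v : cube => sgnb (v i) * sgnb (v j) * P v) (flipK i).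
have e' : avg (fun v : cube => sgnb (v i) * sgnb (v j) * P v) =
    avg (fun v : cube => sgnb (v i) * sgnb (v j) * (2^-1 * (P v - P (flip i v)))).
  have -> : (fun v : cube => sgnb (v i) * sgnb (v j) * (2^-1 * (P v - P (flip i v)))) =
      (fun v : cube => 2^-1 * (sgnb (v i) * sgnb (v j) * P v +
        sgnb (flip i v i) * sgnb (flip i v j) * P (flip i v))).
    apply/funext => v; rewrite !ffunE eqxx eq_sym (negbTE ij) sgnbN; ring.
  by rewrite avgZ avgD -[avg (fun v : cube => _ * _ * P (flip i v))]e; lra.
rewrite e' -(avg_cst ([ffun=> true] : cube) (3 / 2 * Del)); apply: ler_avg => v.
rewrite (le_trans (ler_norm _))// !normrM !normr_sgnb !mul1r ger0_norm ?invr_ge0//.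
have h : `|P v - P (flip i v)| <= 3 * Del.
  apply: Eflip_signed => x; rewrite normrM -[leRHS]mulr1.
  by apply: ler_pM.
lra.
Qed.

Lemma second_moment_bound :
  avg (fun v : cube => E v (fun x => (win v x)%:R)) <= (d%:R^-1 + 3 / 2 * Del) / b ^+ 2.
Proof.
have db0 : 0 < (d%:R * b) ^+ 2 by rewrite exprn_gt0// mulr_gt0.
pose S v x := \sum_i sgnb (v i) * xi i x.
have Ewin v : E v (fun x => (win v x)%:R) <=
    ((d%:R * b) ^+ 2)^-1 * E v (fun x => S v x ^+ 2).
  rewrite -EZ; apply: Emono => x; case: (boolP (win v x)) => [/win_corr h|_].
    rewrite mulrC ler_pdivlMr// mul1r ler_pXn2r ?nnegrE//.
      by rewrite mulr_ge0 ?ltW.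
    by rewrite (le_trans _ h)// mulr_ge0// ltW.
  by rewrite mulr_ge0 ?sqr_ge0// invr_ge0 ltW.
apply: (le_trans (ler_avg Ewin)); rewrite avgZ.
have SE v : E v (fun x => S v x ^+ 2) =
    \sum_i \sum_j E v (fun x => (sgnb (v i) * xi i x) * (sgnb (v j) * xi j x)).
  rewrite -(eq_bigr _ (fun i _ => Esum v
    (fun j x => (sgnb (v i) * xi i x) * (sgnb (v j) * xi j x)))).
  rewrite -Esum; congr (E v); apply/funext => x.
  by rewrite /S expr2 mulr_suml; apply: eq_bigr => i _; rewrite mulr_sumr.
under eq_avg do rewrite SE.
rewrite avg_sum; under eq_bigr do rewrite avg_sum.
have bnd : \sum_i \sum_j avg (fun v : cube => E v (fun x =>
     (sgnb (v i) * xi i x) * (sgnb (v j) * xi j x))) <=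
    \sum_(i < d) (1 + d%:R * (3 / 2 * Del)).
  apply: ler_sum => i _; rewrite (bigD1 i)//=; apply: lerD.
    rewrite -(avg_cst ([ffun=> true] : cube) 1); apply: ler_avg => v.
    apply: le_trans (E1 v); apply: Emono => x.
    rewrite -expr2 exprMn sgnb_sqr mul1r -real_normK ?num_real//.
    by rewrite exprn_ile1.
  apply: (@le_trans _ _ (\sum_(j < d | j != i) (3 / 2 * Del))).
    by apply: ler_sum => j ji; apply: avg_cross; rewrite eq_sym.
  have -> : d%:R * (3 / 2 * Del) = \sum_(j < d) (3 / 2 * Del).
    by rewrite sumr_const card_ord mulr_natl.
  rewrite big_mkcond/=.
  by apply: ler_sum => j _; case: ifP => // _; rewrite mulr_ge0.
apply: (@le_trans _ _ (((d%:R * b) ^+ 2)^-1 * (d%:R * (1 + d%:R * (3 / 2 * Del))))).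
  rewrite ler_wpM2l ?invr_ge0 ?(ltW db0)//; apply: (le_trans bnd).
  by rewrite sumr_const card_ord [leRHS]mulr_natl.
rewrite le_eqVlt; apply/orP; left; apply/eqP; field.
by rewrite !gt_eqF.
Qed.

Lemma Echain v u G : (forall x, 0 <= G x <= 1) -> `|E v G - E u G| <= d%:R * Del.
Proof.
move=> G01; pose hyb k : cube := [ffun i : 'I_d => if (i < k)%N then u i else v i].
have h k : (k <= d)%N -> `|E v G - E (hyb k) G| <= k%:R * Del.
  elim: k => [|k IH] kd.
    rewrite (_ : hyb 0%N = v) ?subrr ?normr0 ?mul0r//.
    by apply/ffunP => i; rewrite ffunE.
  pose i : 'I_d := Ordinal kd.
  have step : `|E (hyb k) G - E (hyb k.+1) G| <= Del.
    have [uv|uv] := eqVneq (u i) (v i).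
      rewrite (_ : hyb k.+1 = hyb k) ?subrr ?normr0//.
      apply/ffunP => j; rewrite !ffunE ltnS leq_eqVlt.
      have [jk|//] := eqVneq (nat_of_ord j) k.
      by rewrite jk ltnn/= (_ : j = i)//; apply/val_inj.
    rewrite (_ : hyb k.+1 = flip i (hyb k)); first exact: Eflip.
    apply/ffunP => j; rewrite !ffunE ltnS leq_eqVlt.
    have [->|ji] := eqVneq j i.
      by rewrite /= eqxx ltnn; move: uv; case: (u i); case: (v i).
    have -> // : (nat_of_ord j == k) = false.
    by apply: contraNF ji => /eqP e; apply/eqP/val_inj.
  have -> : E v G - E (hyb k.+1) G =
    (E v G - E (hyb k) G) + (E (hyb k) G - E (hyb k.+1) G) by ring.
  rewrite (le_trans (ler_normD _ _))// -natr1 mulrDl mul1r lerD// IH//.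
  exact: ltnW.
have := h d (leqnn d); rewrite (_ : hyb d = u)//.
by apply/ffunP => i; rewrite ffunE ltn_ord.
Qed.

Lemma two_point_bound :
  avg (fun v : cube => E v (fun x => (win v x)%:R)) <= 1 / 2 + d%:R * Del / 2.
Proof.
pose W v x : R := (win v x)%:R.
pose op (v : cube) : cube := [ffun i => ~~ v i].
have opK : involutive op by move=> v; apply/ffunP => i; rewrite !ffunE negbK.
have -> : avg (fun v : cube => E v (W v)) =
    avg (fun v : cube => 2^-1 * (E v (W v) + E (op v) (W (op v)))).
  rewrite avgZ avgD; have e := reindex_avg (fun v : cube => E v (W v)) opK.
  by rewrite -[avg (fun v : cube => E (op v) _)]e; lra.
rewrite -(avg_cst ([ffun=> true] : cube) (1 / 2 + _)); apply: ler_avg => v.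
have W01 x : 0 <= 1 - W v x <= 1.
  by rewrite /W; case: (win v x); rewrite ?subrr ?subr0 ?lexx ?ler01.
have disj x : W (op v) x <= 1 - W v x.
  rewrite /W; case: (boolP (win v x)) => [/win_corr h1|_]; last first.
    by rewrite subr0; case: (win _ _).
  case: (boolP (win (op v) x)) => [/win_corr h2|_]; last by rewrite subrr.
  have : \sum_i sgnb (op v i) * xi i x = - \sum_i sgnb (v i) * xi i x.
    by rewrite -sumrN; apply: eq_bigr => i _; rewrite ffunE sgnbN mulNr.
  have : 0 < d%:R * b by exact: mulr_gt0.
  lra.
have h1 : E (op v) (W (op v)) <= E (op v) (fun x => 1 - W v x) by exact: Emono.
have h2 := Echain (op v) v W01.
have h3 : E v (fun=> 1) = E v (W v) + E v (fun x => 1 - W v x).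
  by rewrite -ED; congr (E v); apply/funext => x; ring.
have h4 := E1 v.
move: h2; rewrite ler_norml => h2; lra.
Qed.

Lemma win_bound :
  avg (fun v : cube => E v (fun x => (win v x)%:R)) <= 1 / 2 + 3 / 2 * (Del / b ^+ 2).
Proof.
have b20 : 0 < b ^+ 2 by rewrite exprn_gt0.
have [dbig|dsmall] := leP (3 / b ^+ 2) d%:R.
  apply: (le_trans second_moment_bound).
  rewrite mulrDl -mulrA; apply: lerD => //.
  rewrite ler_pdivrMr//.
  have : d%:R^-1 <= b ^+ 2 / 3.
    by rewrite -[leRHS]invrK lef_pV2 ?posrE ?invr_gt0 ?divr_gt0// invf_div.
  lra.
apply: (le_trans two_point_bound); rewrite lerD2l.
have : d%:R * Del <= 3 / b ^+ 2 * Del by rewrite ler_wpM2r// ltW.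
rewrite [3 / _ * _]mulrAC; lra.
Qed.

End correlation.

Section noise_term.
Context {R : realType}.

Lemma clip_dist (r t : R) (s : bool) : 0 < r ->
  r * (1 - sgnb s * dsabs r t) <= `|t - r * sgnb s|.
Proof.
move=> r0.
have [tr|tr] := leP r t.
  rewrite dsabs_ge//; apply: le_trans (ler_norm _).
  by case: s; rewrite /sgnb; lra.
have [tr'|tr'] := leP t (- r).
  rewrite dsabs_le//; rewrite -normrN; apply: le_trans (ler_norm _).
  by case: s; rewrite /sgnb; lra.
have -> : dsabs r t = t / r.
  rewrite /dsabs min_r; last by rewrite ler_pdivrMr// mul1r ltW.
  by rewrite max_r// ler_pdivlMr// mulN1r ltW.
have -> : r * (1 - sgnb s * (t / r)) = r - sgnb s * t.
  by field; rewrite gt_eqF.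
case: s; rewrite /sgnb ?mul1r ?mulr1 ?mulN1r ?mulrN1 ?opprK.
  by rewrite -normrN opprB ler_norm.
by rewrite addrC ler_norm.
Qed.

Lemma cube_correlation (d : nat) (gamma r eps a : R) v (x : 'rV[R]_d) :
  0 < gamma -> 0 < r -> a < 1 -> eps = a * (gamma * (d%:R * r)) ->
  eps_optimal eps (cube_instance gamma r (r * (1 - a)) v) x ->
  d%:R * ((1 - a) / 2) <= \sum_i sgnb (v i) * dsabs r (x ord0 i).
Proof.
move=> g0 r0 a1 epsE; set mu := r * (1 - a).
have mu0 : 0 < mu by rewrite mulr_gt0// subr_gt0.
move=> /(eps_optimal_le (cube_min r g0 mu0 v)).
rewrite /cube_instance sum_sabs_center epsE [a * _]mulrCA -mulrDr ler_pM2l// => xopt.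
have h1 := le_trans (sum_sabs_ge mu0 (cube_center r v) x) xopt.
have h2 : \sum_i r * (1 - sgnb (v i) * dsabs r (x ord0 i)) <=
    \sum_i `|x ord0 i - cube_center r v ord0 i|.
  by apply: ler_sum => i _; rewrite mxE; exact: clip_dist.
have := le_trans h2 h1; rewrite -mulr_sumr sumrB sumr_const card_ord.
set S := \sum_i _; rewrite -[1 *+ d]/(d%:R) => h3.
rewrite -(ler_pM2l r0); rewrite /mu in h3; lra.
Qed.

(* In the constant, [80] comes from [rademacher_subexp], and [2 * 18 ^+ 2] from
   [(b ^+ 2 / 9) ^+ 2 <= 4 T / (2 m + 1)] and the rounding of [m]. *)
Lemma noise_term_bound (a : R) (d : nat) (L Rad eps sigma delta : R)
    (A : algorithm R d) (T : nat) :
  0 < a -> a < 1 ->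
  (0 < d)%N -> 0 < L -> 0 < Rad -> 0 < sigma -> 0 < delta -> delta < 1 ->
  0 < eps -> eps <= a * (L * Rad) ->
  solves_SCO A T L Rad eps sigma delta (2 / 3) ->
  a ^+ 2 * ((1 - a) / 2) ^+ 4 / (2 * 18 ^+ 2 * 80 ^+ 2) *
    (Rad ^+ 2 * sigma ^+ 2 / (eps ^+ 2 * ln (1 / delta) ^+ 2)) <= T%:R.
Proof.
move=> a0 a1 d0 L0 Rad0 s0 dl0 dl1 e0 eps_le solves.
have dR0 : 0 < d%:R :> R by rewrite ltr0n.
have sd0 : 0 < Num.sqrt d%:R :> R by rewrite sqrtr_gt0.
have sd2 : Num.sqrt d%:R * Num.sqrt d%:R = d%:R :> R by rewrite -expr2 sqr_sqrtr// ltW.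
pose t := ln (1 / delta).
have t0 : 0 < t by rewrite ln_gt0// ltr_pdivlMr// mul1r.
pose gamma := eps / (a * Rad * Num.sqrt d%:R); pose r := Rad / Num.sqrt d%:R.
have g0 : 0 < gamma by rewrite divr_gt0// !mulr_gt0.
have r0 : 0 < r by rewrite divr_gt0.
pose mu := r * (1 - a).
have mu0 : 0 < mu by rewrite mulr_gt0// subr_gt0.
have epsE : eps = a * (gamma * (d%:R * r)).
  by rewrite -sd2 /gamma /r; field; rewrite !gt_eqF.
pose M := a ^+ 2 * (Rad ^+ 2 * sigma ^+ 2 / (eps ^+ 2 * t ^+ 2)) / 80 ^+ 2.
have ME : gamma ^+ 2 * M = (sigma / Num.sqrt d%:R / (80 * t)) ^+ 2.
  by rewrite /M /gamma; field; rewrite !gt_eqF.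
have M0 : 0 <= M / 2.
  by rewrite /M; do ![exact: sqr_ge0 | apply: mulr_ge0 | rewrite invr_ge0].
pose m := Num.truncn (M / 2).
have /andP[m1 m2] := truncn_itv M0; rewrite -/m in m1 m2.
have mM : gamma ^+ 2 * (2 * m)%:R <= (sigma / Num.sqrt d%:R / (80 * t)) ^+ 2.
  by rewrite -ME ler_pM2l ?exprn_gt0// natrM; lra.
pose w0 : {ffun 'I_d * (unit + bool * 'I_m) -> bool} := [ffun=> true].
pose v0 : {ffun 'I_d -> bool} := [ffun=> true].
pose f v := cube_instance gamma r mu v : 'rV[R]_d -> R.
pose b := (1 - a) / 2.
have b0 : 0 < b by rewrite divr_gt0// subr_gt0.
pose Del := Num.sqrt (4 * (T%:R / (2 * m).+1%:R) : R).
have key : 2 / 3 <= 1 / 2 + 3 / 2 * (Del / b ^+ 2).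
  apply: (@avg_success_probability R d _ _ w0 v0
    (fun v w => @noisy_gradient R d m gamma r mu v w)
    (fun v => @measurable_noisy_gradient R d m gamma r mu v) A
    (fun v => eps_optimal eps (f v)) T) => [v|v|s].
  - apply: measurable_eps_optimal; apply: measurable_funM => //.
    exact: measurable_sum_sabs.
  - apply: solves.
      apply: cube_sco => //.
        rewrite /gamma invfM mulrA divfK ?gt_eqF// ler_pdivrMr ?mulr_gt0//.
        by rewrite mulrCA.
      by rewrite gtr0_norm// /r mulrC divfK ?gt_eqF.
    exact: cube_ISGO.
  - have <- : avg (fun v => run_value (@noisy_gradient R d m gamma r mu v)
        (fun x => (x \in eps_optimal eps (f v))%:R) T s [tuple]) =
      avg (fun v => run_value (fun w => @noisy_gradient R d m gamma r mu v w)
        \1_(eps_optimal eps (f v)) T s [tuple]).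
      by apply: eq_avg => v; apply: eq_run_value => x; rewrite indicE.
    apply: (@win_bound R d 'rV[R]_d
      (fun v G => run_value (@noisy_gradient R d m gamma r mu v) G T s [tuple])
      (fun i x => dsabs r (x ord0 i)) b Del d0 b0 _ _ _ _ _ _ _
      (fun v x => x \in eps_optimal eps (f v))).
    + by move=> v G H; exact: run_valueD.
    + by move=> v c G; exact: run_valueZ.
    + by move=> v J G; exact: run_value_sum.
    + by move=> v G H GH; exact: ler_run_value.
    + by move=> v; apply: (run_value_le1 w0) => x.
    + move=> v i G G01; rewrite /Del -(ler_pXn2r (n := 2)) ?nnegrE ?sqrtr_ge0//.
      rewrite [leRHS]sqr_sqrtr; last by rewrite mulr_ge0// divr_ge0.
      exact: run_value_flip.
    + by move=> i x; exact: dsabs_norm.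
    + by move=> v x /set_mem; exact: cube_correlation.
have b2 : 0 < b ^+ 2 by rewrite exprn_gt0.
have Db : b ^+ 2 / 9 <= Del.
  have : 9^-1 <= Del / b ^+ 2 by lra.
  by rewrite ler_pdivlMr// mulrC.
have : (b ^+ 2 / 9) ^+ 2 <= 4 * (T%:R / (2 * m).+1%:R).
  rewrite -[leRHS]sqr_sqrtr; last by rewrite mulr_ge0// divr_ge0.
  by rewrite ler_sqr ?nnegrE ?sqrtr_ge0// divr_ge0// ltW.
have n0 : 0 < (2 * m).+1%:R :> R by rewrite ltr0n.
rewrite mulrA ler_pdivlMr// => hT.
have nM : M / 2 <= (2 * m).+1%:R.
  rewrite (le_trans (ltW m2))// ler_nat ltnS leq_pmull//.
have b40 : 0 <= (b ^+ 2 / 9) ^+ 2 by exact: sqr_ge0.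
have := le_trans (ler_wpM2l b40 nM) hT.
rewrite -/t -/b /M; set X := _ / (_ * t ^+ 2); set Y := a ^+ 2 => h.
have -> : b ^+ 4 = (b ^+ 2) ^+ 2 by rewrite -exprM.
lra.
Qed.

End noise_term.

Theorem corollary2 (R : realType) (a : R) (ha0 : 0 < a) (ha1 : a < 1) :
  exists (c : R) (k : nat), 0 < c /\
    forall (d : nat) (L Rad eps sigma delta : R) (A : algorithm R d) (T : nat),
      (0 < d)%N -> 0 < L -> 0 < Rad -> 0 < sigma -> 0 < delta -> delta < 1 ->
      0 < eps -> eps <= a * (L * Rad) ->
      solves_SCO A T L Rad eps sigma delta (2 / 3) ->
      c / (1 + ln d%:R) ^+ k *
        (Rad ^+ 2 * sigma ^+ 2 / (eps ^+ 2 * ln (1 / delta) ^+ 2)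
         + Num.min (Rad ^+ 2 * L ^+ 2 / eps ^+ 2) d%:R)
      <= T%:R.
Proof.
pose c1 : R := a ^+ 2 * ((1 - a) / 2) ^+ 4 / (2 * 18 ^+ 2 * 80 ^+ 2).
pose c2 : R := a * ln (4 / 3) / 6.
have c10 : 0 < c1.
  rewrite /c1; do ![apply: exprn_gt0 | apply: mulr_gt0 | rewrite invr_gt0] => //.
  by rewrite subr_gt0.
have c20 : 0 < c2 by rewrite divr_gt0// mulr_gt0// ln_gt0//; lra.
exists (Num.min c1 c2 / 2), 1%N; split; first by rewrite divr_gt0// lt_min c10.
move=> d L Rad eps sigma delta A T d0 L0 Rad0 s0 dl0 dl1 e0 eps_le solves.
have h1 := noise_term_bound ha0 ha1 d0 L0 Rad0 s0 dl0 dl1 e0 eps_le solves.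
have h2 := dimension_term_bound ha0 ha1 d0 L0 Rad0 s0 dl0 e0 eps_le solves.
rewrite -/c1 in h1; rewrite -/c2 in h2.
have l0 : 0 <= ln d%:R :> R by rewrite ln_ge0// ler1n.
have l1 : 0 < 1 + ln d%:R :> R by lra.
rewrite expr1 mulrAC ler_pdivrMr//.
set X := _ / (_ * _) in h1 *; set Y := Num.min _ _ in h2 *.
have X0 : 0 <= X.
  by rewrite /X; do ![exact: sqr_ge0 | apply: mulr_ge0 | rewrite invr_ge0].
have Y0 : 0 <= Y.
  rewrite /Y le_min ler0n andbT.
  by do ![exact: sqr_ge0 | apply: mulr_ge0 | rewrite invr_ge0].
have e1 : Num.min c1 c2 * X <= c1 * X by rewrite ler_wpM2r// ge_min lexx.
have e2 : Num.min c1 c2 * Y <= c2 * Y by rewrite ler_wpM2r// ge_min lexx orbT.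
have e3 : T%:R <= T%:R * (1 + ln d%:R) :> R by rewrite ler_peMr//; lra.
lra.
Qed.
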